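(* Let $(a,b)\times R\subseteq\mathbb{R}^{d+1}=\mathbb{R}\times\mathbb{R}^d$ be a (possibly unbounded) rectangle, $R=\prod_{k=1}^d(a_k,b_k)$, and let $f$ be a summable function on $(a,b)\times R$. Write points of $\mathbb{R}^{d+1}$ as $(x,\mathbf{y})$ with $x\in\mathbb{R}$, $\mathbf{y}\in\mathbb{R}^d$. Then: (1) the function $\mathbf{y}\mapsto f(x,\mathbf{y})$ is summable on $R$ for a.e. $x\in(a,b)$; (2) the function $x\mapsto\int_R f(x,\mathbf{y})\,d\mathbf{y}$ is a.e. defined and summable on $(a,b)$; (3) the following reduction formula holds: $$\int_{(a,b)\times R}f(x,\mathbf{y})\,d(x,\mathbf{y})=\int_a^b\Big[\int_R f(x,\mathbf{y})\,d\mathbf{y}\Big]dx .$$ All integrals are Lebesgue integrals in the sense of Tonelli (defined in the context).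
   Context: The following definitions are used in $\mathbb{R}^n$ for every $n\ge1$. A rectangle is a product of $n$ intervals of the real line; $L$ of a rectangle is the product of the lengths of its sides. A multirectangle $\Delta=\{R_j\}$ is a finite or countable sequence of rectangles (not necessarily disjoint, no topological condition); $\mathcal{I}_\Delta=\bigcup_jR_j$ and $L(\Delta)=\sum_jL(R_j)$. A set $N$ is a null set if for every $\varepsilon>0$ there is a multirectangle $\Delta$ with $L(\Delta)<\varepsilon$, $N\subseteq\mathcal{I}_\Delta$; a.e. means outside a null set. For $0<\rho\le+\infty$ put $D_\rho=\{x\in\mathbb{R}^n:\|x\|\le\rho\}$ ($D_{+\infty}=\mathbb{R}^n$). A real function $f$ a.e. defined on $D_\rho$ is quasicontinuous if for every $\varepsilon>0$ there is a multirectangle $\Delta$ with $L(\Delta)<\varepsilon$ and $\mathcal{I}_\Delta$ open such that $f$ is defined and its restriction is continuous on $D_\rho\setminus\mathcal{I}_\Delta$. Lebesgue integral (Tonelli), bounded case: if $f$ is bounded quasicontinuous on $D_\rho$, $\rho<+\infty$, choose $\varepsilon_j\to0^+$, multirectangles $\Delta_j$ with $L(\Delta_j)<\varepsilon_j$, $\mathcal{I}_{\Delta_j}$ open, $f_{|D_\rho\setminus\mathcal{I}_{\Delta_j}}$ continuous, and continuous extensions $f_j$ of $f_{|D_\rho\setminus\mathcal{I}_{\Delta_j}}$ to $\mathbb{R}^n$ with the same infimum and supremum. Then $\int_{D_\rho}f:=\lim_j\int_{D_\rho}f_j$ (Riemann integrals on the right; the limit exists and is independent of the choices). General case: for $f$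 quasicontinuous on $\mathbb{R}^n$ put $f_+=\max\{f,0\}$, $f_-=\min\{f,0\}$, $\int_{\mathbb{R}^n}f_+:=\lim_{\rho,N\to+\infty}\int_{D_\rho}\min\{f_+,N\}$, $\int_{\mathbb{R}^n}f_-:=\lim_{\rho,K\to+\infty}\int_{D_\rho}\max\{f_-,-K\}$. The function $f$ is integrable if at least one of these is finite, and then $\int_{\mathbb{R}^n}f:=\int f_++\int f_-$; it is summable if this is finite. For a set $A$ whose characteristic function is quasicontinuous, $f$ (a.e. defined on $A$) is quasicontinuous, integrable or summable on $A$ if its extension by $0$ outside $A$ is quasicontinuous, integrable or summable on $\mathbb{R}^n$, and $\int_Af$ is the integral over $\mathbb{R}^n$ of that extension. *)

(* Defs.v *)
From HB Require Import structures.
From mathcomp Require Import all_boot all_order all_algebra.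
From mathcomp Require Import all_classical all_reals all_analysis.

Set Implicit Arguments.
Unset Strict Implicit.
Unset Printing Implicit Defensive.

Import Order.TTheory GRing.Theory Num.Theory.
Import numFieldNormedType.Exports.

Local Open Scope classical_set_scope.
Local Open Scope ring_scope.

(* Points of R^n are row vectors 'rV[R]_n. A real function that need not be
   defined everywhere is a map 'rV[R]_n -> option R, None meaning undefined. *)

Section Multirectangles.
Context {R : realType} {n : nat}.

(* Any kind of interval is allowed: open, closed, empty, unbounded. *)
Definition rectangle := 'I_n -> interval R.

Definition rect_set (r : rectangle) : set 'rV[R]_n :=
  [set x | forall i, x ord0 i \in r i].

Definition itv_length (I : interval R) : \bar R :=
  (if (I.1 : \bar R) < I.2 then (I.2 : \bar R) - I.1 else 0)%E.

(* In \bar R, 0 * +oo = 0: an unbounded rectangle with a degenerate side has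
   L = 0. *)
Definition rect_L (r : rectangle) : \bar R :=
  (\prod_(i < n) itv_length (r i))%E.

(* A finite sequence of rectangles is padded with empty rectangles, which
   change neither the union nor the total length. *)
Definition multirectangle := nat -> rectangle.

Definition mrect_set (Delta : multirectangle) : set 'rV[R]_n :=
  \bigcup_j rect_set (Delta j).

Definition mrect_L (Delta : multirectangle) : \bar R :=
  (\sum_(0 <= j <oo) rect_L (Delta j))%E.

Definition null_set (N : set 'rV[R]_n) : Prop :=
  forall e : R, 0 < e ->
    exists Delta : multirectangle,
      (mrect_L Delta < e%:E)%E /\ N `<=` mrect_set Delta.

Definition ae_on (A : set 'rV[R]_n) (P : 'rV[R]_n -> Prop) : Prop :=
  exists N, null_set N /\ forall x, A x -> ~ N x -> P x.

End Multirectangles.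

Section Quasicontinuity.
Context {R : realType} {n : nat}.
Implicit Types f : 'rV[R]_n -> option R.

Definition enorm (x : 'rV[R]_n) : R := Num.sqrt (\sum_(i < n) x ord0 i ^+ 2).

Definition disc (rho : \bar R) : set 'rV[R]_n :=
  [set x | ((enorm x)%:E <= rho)%E].

Definition defined_at f (x : 'rV[R]_n) : Prop := f x <> None.

(* The value of f; the default 0 is only ever read where f is defined. *)
Definition pval f (x : 'rV[R]_n) : R := odflt 0 (f x).

Definition continuous_off (rho : \bar R) f (e : R)
    (Delta : multirectangle (R := R) (n := n)) : Prop :=
  [/\ (mrect_L Delta < e%:E)%E,
      open (mrect_set Delta),
      forall x, (disc rho `\` mrect_set Delta) x -> defined_at f x &
      {within disc rho `\` mrect_set Delta, continuous (pval f)}].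

Definition quasicontinuous (rho : \bar R) f : Prop :=
  ae_on (disc rho) (defined_at f) /\
  forall e : R, 0 < e -> exists Delta, continuous_off rho f e Delta.

End Quasicontinuity.

(* Riemann (Darboux) integral over disc rho of a function bounded on it: the
   function is extended by 0 to the cube [-rho, rho]^n. Every axis of a grid
   carries the same number N of possibly degenerate subintervals, which is no
   restriction since points may be repeated. *)
Section Riemann.
Context {R : realType} {n : nat}.

Definition grid (rho : R) (N : nat) (t : 'I_n -> nat -> R) : Prop :=
  forall i, [/\ t i 0%N = - rho, t i N = rho &
                forall k, (k < N)%N -> t i k <= t i k.+1].

Definition cell N (t : 'I_n -> nat -> R) (k : {ffun 'I_n -> 'I_N}) :
    set 'rV[R]_n :=
  [set x | forall i, t i (k i) <= x ord0 i <= t i (k i).+1].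

Definition cell_volume N (t : 'I_n -> nat -> R) (k : {ffun 'I_n -> 'I_N}) : R :=
  \prod_(i < n) (t i (k i).+1 - t i (k i)).

Definition lower_sum N t (h : 'rV[R]_n -> R) : R :=
  \sum_(k : {ffun 'I_n -> 'I_N}) inf (h @` cell t k) * cell_volume t k.

Definition upper_sum N t (h : 'rV[R]_n -> R) : R :=
  \sum_(k : {ffun 'I_n -> 'I_N}) sup (h @` cell t k) * cell_volume t k.

Definition is_riemann_integral (rho : R) (g : 'rV[R]_n -> R) (I : R) : Prop :=
  let h x := g x * \1_(disc rho%:E) x in
  sup [set s | exists N t, grid rho N t /\ s = lower_sum N t h] = I /\
  inf [set s | exists N t, grid rho N t /\ s = upper_sum N t h] = I.

End Riemann.

Section Integral.
Context {R : realType} {n : nat}.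
Implicit Types f : 'rV[R]_n -> option R.

Definition is_extension (rho : \bar R) f
    (Delta : multirectangle (R := R) (n := n)) (g : 'rV[R]_n -> R) : Prop :=
  let D := disc rho `\` mrect_set Delta in
  [/\ continuous g,
      forall x, D x -> g x = pval f x,
      ereal_inf [set (g x)%:E | x in [set: 'rV[R]_n]] =
        ereal_inf [set (pval f x)%:E | x in D] &
      ereal_sup [set (g x)%:E | x in [set: 'rV[R]_n]] =
        ereal_sup [set (pval f x)%:E | x in D]].

Definition is_bounded_integral (rho : R) f (I : R) : Prop :=
  exists (e : nat -> R) (Delta : nat -> multirectangle)
         (g : nat -> 'rV[R]_n -> R) (r : nat -> R),
    [/\ (forall j, 0 < e j) /\ e j @[j --> \oo] --> (0 : R),
        forall j, continuous_off rho%:E f (e j) (Delta j),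
        forall j, is_extension rho%:E f (Delta j) (g j),
        forall j, is_riemann_integral rho (g j) (r j) &
        r j @[j --> \oo] --> I].

(* Meaningful for f bounded and quasicontinuous on disc rho: I then exists and
   does not depend on the choices. *)
Definition bounded_integral (rho : R) f : R := get (is_bounded_integral rho f).

Definition trunc_pos (N : R) f : 'rV[R]_n -> option R :=
  fun x => omap (fun v => Num.min (Num.max v 0) N) (f x).

Definition trunc_neg (K : R) f : 'rV[R]_n -> option R :=
  fun x => omap (fun v => Num.max (Num.min v 0) (- K)) (f x).

(* The second is the integral of f_- = min{f, 0}, hence nonpositive. *)
Definition integral_pos f : \bar R :=
  lim ((bounded_integral p.1 (trunc_pos p.2 f))%:E
         @[p --> filter_prod (pinfty_nbhs R) (pinfty_nbhs R)]).

Definition integral_neg f : \bar R :=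
  lim ((bounded_integral p.1 (trunc_neg p.2 f))%:E
         @[p --> filter_prod (pinfty_nbhs R) (pinfty_nbhs R)]).

Definition tonelli_integrable f : Prop :=
  quasicontinuous +oo%E f /\
  (integral_pos f \is a fin_num \/ integral_neg f \is a fin_num).

Definition tonelli_integral f : \bar R := (integral_pos f + integral_neg f)%E.

Definition tonelli_summable f : Prop :=
  tonelli_integrable f /\ tonelli_integral f \is a fin_num.

Definition extend0 (A : set 'rV[R]_n) f : 'rV[R]_n -> option R :=
  fun x => if x \in A then f x else Some 0.

Definition summable_on (A : set 'rV[R]_n) f : Prop :=
  [/\ quasicontinuous +oo%E (fun x => Some (\1_A x : R)),
      ae_on A (defined_at f) &
      tonelli_summable (extend0 A f)].

Definition integral_on (A : set 'rV[R]_n) f : \bar R :=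
  tonelli_integral (extend0 A f).

End Integral.

Section Reduction.
Context {R : realType}.

Definition open_box n (a b : 'I_n -> \bar R) : set 'rV[R]_n :=
  [set x | forall i, (a i < (x ord0 i)%:E < b i)%E].

(* A one-dimensional interval as a subset of R^1, identified with R. *)
Definition open_interval (a b : \bar R) : set 'rV[R]_1 :=
  open_box (fun=> a) (fun=> b).

Definition prod_set m n (A : set 'rV[R]_m) (B : set 'rV[R]_n) :
    set 'rV[R]_(m + n) :=
  [set z | A (lsubmx z) /\ B (rsubmx z)].

Definition slice m n (f : 'rV[R]_(m + n) -> option R) (x : 'rV[R]_m) :
    'rV[R]_n -> option R :=
  fun y => f (row_mx x y).

(* The real function x |-> \int_B f(x, y) dy, defined exactly at those x for
   which f(x, .) is summable on B. *)
Definition partial_integral m n (B : set 'rV[R]_n)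
    (f : 'rV[R]_(m + n) -> option R) : 'rV[R]_m -> option R :=
  fun x => if `[< summable_on B (slice f x) >]
           then Some (fine (integral_on B (slice f x))) else None.

End Reduction.

(* Main.v *)
From HB Require Import structures.
Require Import Defs.
From mathcomp Require Import all_boot all_order all_algebra.
From mathcomp Require Import all_classical all_reals all_analysis.
From mathcomp Require Import measurable_realfun.
From mathcomp Require Import lra.

Set Implicit Arguments.
Unset Strict Implicit.
Unset Printing Implicit Defensive.

Import Order.TTheory GRing.Theory Num.Theory.
Import numFieldNormedType.Exports.

Local Open Scope classical_set_scope.
Local Open Scope ring_scope.

(** Once Tonelli's integral is recognised as the Lebesgue integral, the theorem
    is Fubini's theorem for a product measure. The measure is [leb n] on the
    Borel sets of 'rV[R]_n, built by recursion on n as the image of the product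
    of the measure of the line with [leb n.-1]. It gives a rectangle r the mass
    L(r) ([leb_rect_set]), and splitting off the first coordinate is Fubini's
    theorem ([ge0_integral_leb], [integral_leb]).

    A quasicontinuous function agrees, off a Borel null set, with a Borel
    function, called a [version] of it below: it is continuous on each closed
    set R^n \ I_(Delta_j), and these sets fill R^n up to a null set
    ([quasicontinuous_version]).

    Let f be bounded by M, with version g. On the disc every continuous extension
    f_j differs from g only on a set of measure less than e_j, so its integral is
    within 2 M e_j of that of g; its Riemann integral is its Lebesgue integral
    ([is_riemann_integralE]). Hence the limit in Tonelli's definition is the
    Lebesgue integral of g, whatever the choices ([bounded_integralE]); that
    choices exist is Tietze's theorem ([tietze_same_range]). Monotone convergence
    then removes the truncations: f is summable exactly when g is
    Lebesgue-integrable, and the two integrals agree ([tonelli_summableE],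
    [tonelli_integralE]).

    Fubini's theorem for g leaves one thing to prove: the functions obtained by
    slicing and by integrating must be quasicontinuous again.
    - Slices: take multirectangles Delta_j adapted to f with L(Delta_j) -> 0. As a
      function of x, the length of the section of Delta_j at x has integral
      L(Delta_j). By Markov's inequality almost every x therefore has sections of
      arbitrarily small length, and these sections witness the quasicontinuity
      of f(x, .) ([quasicontinuous_slice]). Applied to the characteristic
      function of (a, b) x R, this also gives the quasicontinuity of that of R.
    - Partial integrals: x |-> \int g(x, y) dy is a Borel function on the line
      which agrees almost everywhere with the partial integral of f extended by
      0, and a function with that property is quasicontinuous by Lusin's theorem
      ([quasicontinuous1]). *)

(** * The Borel sets of R^n *)

HB.instance Definition _ (R : realType) n :=
  Measurable.copy 'rV[R]_n (g_sigma_algebraType (@open 'rV[R]_n)).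

Section Borel.
Context {R : realType}.

Lemma open_measurable_rV n (U : set 'rV[R]_n) : open U -> measurable U.
Proof. by move=> oU; exact: sub_sigma_algebra. Qed.

Lemma closed_measurable_rV n (U : set 'rV[R]_n) : closed U -> measurable U.
Proof.
by move=> /closed_openC/open_measurable_rV/measurableC; rewrite setCK.
Qed.

Lemma measurable_fun_rV d (T : measurableType d) n (f : T -> 'rV[R]_n) :
  (forall U, open U -> measurable (f @^-1` U)) -> measurable_fun setT f.
Proof.
move=> mf; apply: (@measurability _ _ _ _ _ f (@open 'rV[R]_n)) => //.
by move=> _ [U oU <-]; rewrite setTI; exact: mf.
Qed.

(** Restricting to a closed D makes relatively open sets Borel. *)
Lemma continuous_within_measurable n (D : set 'rV[R]_n) (f : 'rV[R]_n -> R) :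
  closed D -> {within D, continuous f} -> measurable_fun D f.
Proof.
move=> cD /continuousP cf; apply: (measurability _ (RGenOpens.measurableE R)).
move=> _ [_ [a [b ->] <-]].
have oab : open (`]a, b[%classic : set R) by exact: interval_open.
have [V oV VE] := (open_subspaceP D _).1 (cf _ oab).
rewrite setIC -VE.
by apply: measurableI; [exact: open_measurable_rV|exact: closed_measurable_rV].
Qed.

Lemma continuous_measurable_rV n (f : 'rV[R]_n -> R) :
  continuous f -> measurable_fun setT f.
Proof.
move=> cf; apply: continuous_within_measurable; first exact: closedT.
exact: continuous_subspaceT.
Qed.

Lemma measurable_coord n (i : 'I_n) :
  measurable_fun setT (fun x : 'rV[R]_n => x ord0 i).
Proof. by apply: continuous_measurable_rV => x; exact: coord_continuous. Qed.

Definition rat_box n (cr : 'rV[rat]_n * rat) : set 'rV[R]_n :=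
  ball (map_mx (@ratr R) cr.1) (ratr cr.2).

(** Second countability of R^n. It is what makes [consV] measurable: the
    product sigma-algebra only sees rectangles, so an open set has to be a
    countable union of them. *)
Lemma open_bigcup_rat_box n (U : set 'rV[R]_n) : open U ->
  U = \bigcup_(cr in [set cr | rat_box cr `<=` U]) rat_box cr.
Proof.
move=> oU; apply/seteqP; split=> [x Ux|x [cr crU /crU//]].
have /nbhs_ballP[e /= e0 xeU] : nbhs x U by exact: open_nbhs_nbhs.
have e2 : 0 < e / 2 by rewrite divr_gt0.
have [q] := rat_in_itvoo e2.
rewrite in_itv/= => /andP[q0 qe].
have cE i : {c : rat | ball (x ord0 i) (ratr q) (ratr c)}.
  have xq : x ord0 i - ratr q < x ord0 i + ratr q by lra.
  apply: cid; have [c] := rat_in_itvoo xq.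
  rewrite in_itv/= => /andP[c1 c2]; exists c; rewrite /ball/= ltr_distlC.
  by apply/andP; split; lra.
have xc : ball (map_mx (@ratr R) (\row_i sval (cE i))) (ratr q) x.
  split=> // i j; rewrite (ord1 i) !mxE.
  by case: (cE j) => c /= xc; exact: ball_sym.
exists (\row_i sval (cE i), q) => //= y xy; apply: xeU.
apply: (@le_ball _ _ _ (ratr q + ratr q)); first lra.
apply: ball_triangle xy; exact/ball_sym.
Qed.

(** The identification of R x R^n with R^(1+n). *)
Definition consV n (p : measurableTypeR R * 'rV[R]_n) : 'rV[R]_(1 + n) :=
  row_mx (const_mx p.1) p.2.

Lemma consV0 n (p : R * 'rV[R]_n) : consV p ord0 (lshift n ord0) = p.1.
Proof. by rewrite row_mxEl mxE. Qed.

Lemma consVS n (p : R * 'rV[R]_n) i : consV p ord0 (rshift 1 i) = p.2 ord0 i.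
Proof. by rewrite row_mxEr. Qed.

Lemma measurable_consV n : measurable_fun setT (@consV n).
Proof.
apply: measurable_fun_rV => U oU; rewrite (open_bigcup_rat_box oU).
rewrite preimage_bigcup bigcup_mkcond.
apply: countable_bigcupT_measurable => [|cr]; first exact: countableP.
case: ifPn => _; last exact: measurable0.
rewrite (_ : _ @^-1` _ = ball (ratr (cr.1 ord0 (lshift n ord0)) : R) (ratr cr.2)
   `*` ball (map_mx (@ratr R) (rsubmx cr.1)) (ratr cr.2)).
  apply: measurableX; first exact: measurable_ball.
  by apply: open_measurable_rV; exact: ball_open.
apply/seteqP; split=> [[x v] /= [r0 H]|[x v] /= [xB [r0 H]]]; split.
- by have := H ord0 (lshift n ord0); rewrite consV0 mxE.
- split=> // i j; have := H ord0 (rshift 1 j).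
  by rewrite (ord1 i) consVS !mxE.
- by [].
- move=> i j; rewrite (ord1 i) mxE.
  case: (split_ordP j) => k ->; first by rewrite [k]ord1 consV0.
  by have := H ord0 k; rewrite consVS !mxE.
Qed.

End Borel.

(** * Lebesgue measure on R^n *)

Section Measure.
Context {R : realType}.
Local Open Scope ereal_scope.

Definition unconsV n (x : 'rV[R]_(1 + n)) : measurableTypeR R * 'rV[R]_n :=
  (x ord0 (lshift n ord0), rsubmx x).

Lemma consVK n : cancel (@consV R n) (@unconsV n).
Proof. by move=> [x v]; rewrite /unconsV consV0 /consV row_mxKr. Qed.

Lemma measurable_unconsV n : measurable_fun setT (@unconsV n).
Proof.
apply/measurable_fun_pair => /=; first exact: measurable_coord.
apply: measurable_fun_rV => U oU; apply: open_measurable_rV.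
by apply: open_comp oU => x _; exact: continuous_rsubmx.
Qed.

(** Lebesgue measure on R^(1+n), if m is Lebesgue measure on R^n. *)
Definition cons_measure n (m : {sigma_finite_measure set 'rV[R]_n -> \bar R}) :
  set 'rV[R]_(1 + n) -> \bar R :=
  pushforward (@lebesgue_measure R \x m) (@consV R n).

Section cons_measure_instance.
Variables (n : nat) (m : {sigma_finite_measure set 'rV[R]_n -> \bar R}).

HB.instance Definition _ := Measure.copy (cons_measure m)
  (measure_function_pushforward__canonical__measure_function_Measure
     (@lebesgue_measure R \x m) (@measurable_consV R n)).

Lemma cons_measure_sigma_finite : sigma_finite setT (cons_measure m).
Proof.
have /sigma_finiteP[F [FT ndF Foo]] := sigma_finiteT (@lebesgue_measure R).
have /sigma_finiteP[G [GT ndG Goo]] := sigma_finiteT m.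
exists (fun k => @unconsV n @^-1` (F k `*` G k)) => [|k].
  apply/esym; rewrite -subTset => x _ /=.
  have [i _ Fi] : (\bigcup_k F k) (unconsV x).1 by rewrite -FT.
  have [j _ Gj] : (\bigcup_k G k) (unconsV x).2 by rewrite -GT.
  exists (maxn i j) => //; split.
    by move: Fi; exact/subsetPset/ndF/leq_maxl.
  by move: Gj; exact/subsetPset/ndG/leq_maxr.
have [mF Fk] := Foo k; have [mG Gk] := Goo k.
have mFG : measurable (F k `*` G k) by exact: measurableX.
split; first by rewrite -[X in measurable X]setTI; exact: measurable_unconsV.
rewrite /cons_measure /pushforward -comp_preimage.
rewrite (_ : _ \o _ = id); last by apply/funext => p; exact: consVK.
by rewrite preimage_id product_measure1E// lte_mul_pinfty// ge0_fin_numE.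
Qed.

HB.instance Definition _ := Measure_isSigmaFinite.Build _ _ _ (cons_measure m)
  cons_measure_sigma_finite.
End cons_measure_instance.

Fixpoint leb n : {sigma_finite_measure set 'rV[R]_n -> \bar R} :=
  match n with
  | 0 => [the {sigma_finite_measure set 'rV[R]_0 -> \bar R}
      of @dirac _ 'rV[R]_0 0%R R]
  | n.+1 => [the {sigma_finite_measure set 'rV[R]_(1 + n) -> \bar R}
      of cons_measure (leb n)]
  end.

Lemma leb_cons n : leb (1 + n) = cons_measure (leb n) :> (set _ -> \bar R).
Proof. by []. Qed.

Lemma ge0_integral_leb n (g : 'rV[R]_(1 + n) -> \bar R) :
  measurable_fun setT g -> (forall x, 0 <= g x) ->
  \int[leb (1 + n)]_x g x =
  \int[lebesgue_measure]_x \int[leb n]_y g (consV (x, y)).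
Proof.
move=> mg g0; rewrite leb_cons /cons_measure.
rewrite (ge0_integral_pushforward (@measurable_consV R n))// preimage_setT.
rewrite fubini_tonelli1//=.
by apply: measurableT_comp => //; exact: measurable_consV.
Qed.

Lemma integral_leb n (g : 'rV[R]_(1 + n) -> \bar R) :
  (leb (1 + n)).-integrable setT g ->
  [/\ {ae lebesgue_measure, forall x,
     (leb n).-integrable setT (fun y => g (consV (x, y)))},
   lebesgue_measure.-integrable setT (fun x => \int[leb n]_y g (consV (x, y))) &
  \int[leb (1 + n)]_x g x =
  \int[lebesgue_measure]_x \int[leb n]_y g (consV (x, y))].
Proof.
move=> ig; have mg := measurable_int _ ig.
have ic : (lebesgue_measure \x leb n).-integrable setT (g \o @consV R n).
  apply/integrableP; split.
    by apply: measurableT_comp => //; exact: measurable_consV.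
  have /integrableP[_] := ig.
  rewrite leb_cons /cons_measure.
  rewrite (ge0_integral_pushforward (@measurable_consV R n))//.
  exact: measurableT_comp.
split.
- exact: ae_integrable1 ic.
- exact: integrable_fubini_F ic.
- rewrite leb_cons /cons_measure.
  rewrite (integral_pushforward (@measurable_consV R n))// preimage_setT.
  by rewrite -integral12_prod_meas1.
Qed.

Lemma measurable_rect_set n (r : rectangle (R:=R) (n:=n)) : measurable (rect_set r).
Proof.
rewrite (_ : rect_set r = \bigcap_(i in [set: 'I_n])
    (fun x : 'rV[R]_n => x ord0 i) @^-1` [set` r i]).
  apply: fin_bigcap_measurable => // i _.
  by rewrite -[X in measurable X]setTI; exact: measurable_coord.
by apply/seteqP; split=> x /= H i; [move=> _ |]; exact: H.
Qed.

(** The convention 0 * +oo = 0 is shared by product measures and [rect_L], so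
    the equality holds for unbounded rectangles with a degenerate side too. *)
Lemma leb_rect_set n (r : rectangle) : leb n (rect_set r) = rect_L r.
Proof.
rewrite /rect_L; elim: n r => [|n IH] r.
  rewrite big_ord0; transitivity (@dirac _ 'rV[R]_0 0%R R (rect_set r)) => //.
  by rewrite diracE mem_set// => -[].
rewrite big_ord_recl.
transitivity ((lebesgue_measure \x leb n)
  ([set` r ord0] `*` rect_set (fun i => r (lift ord0 i)))).
  congr ((_ \x _) _); apply/seteqP; split=> [[x v] H|[x v] [xr H] i]; first split.
  - have := H (@lshift 1 n ord0); rewrite consV0.
    by congr (_ \in r _); apply: val_inj.
  - move=> i; have := H (@rshift 1 n i); rewrite consVS.
    by congr (_ \in r _); apply: val_inj.
  - case: (@split_ordP 1 n i) => j ->; rewrite ?consVS ?[j]ord1 ?consV0.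
      by move: xr; congr (_ \in r _); apply: val_inj.
    by have := H j; congr (_ \in r _); apply: val_inj.
rewrite product_measure1E//; last exact: measurable_rect_set.
by rewrite IH; congr (_ * _); exact: lebesgue_measure_itv.
Qed.
End Measure.

(** * Discs and spheres *)

Section Disc.
Context {R : realType}.

Lemma enorm_continuous n : continuous (@enorm R n).
Proof.
move=> x; apply: (@continuous_comp _ _ _
  (fun x : 'rV[R]_n => \sum_(i < n) x ord0 i ^+ 2) Num.sqrt); last first.
  exact: sqrt_continuous.
move: x.
apply: continuous_big => [|i _ y]; first exact: add_continuous.
apply: (@continuous_comp _ _ _ (fun x : 'rV[R]_n => x ord0 i) (fun z => z ^+ 2)).
  exact: coord_continuous.
exact: exprn_continuous.
Qed.

Lemma enorm_ge0 n (x : 'rV[R]_n) : 0 <= enorm x.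
Proof. exact: sqrtr_ge0. Qed.

Lemma coord_le_enorm n (x : 'rV[R]_n) i : `|x ord0 i| <= enorm x.
Proof.
rewrite -sqrtr_sqr ler_sqrt ?sumr_ge0// => [|j _]; last exact: sqr_ge0.
rewrite (bigD1 i)//= lerDl sumr_ge0// => j _; exact: sqr_ge0.
Qed.

Lemma discE n (r : R) : disc r%:E = [set x : 'rV[R]_n | enorm x <= r].
Proof. by apply/seteqP; split=> x; rewrite /disc/= lee_fin. Qed.

Lemma disc_pinfty n : disc +oo%E = [set: 'rV[R]_n].
Proof. by apply/seteqP; split=> x _ //; rewrite /disc/= leey. Qed.

Lemma closed_disc n (r : \bar R) : closed (disc r : set 'rV[R]_n).
Proof.
case: r => [r| |].
- rewrite discE; have /continuous_closedP cn := @enorm_continuous n.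
  by apply: (cn [set x | x <= r]); exact: closed_le.
- by rewrite disc_pinfty; exact: closedT.
- rewrite (_ : disc _ = set0); first exact: closed0.
  by rewrite -subset0 => x; rewrite /disc/= leeNy_eq.
Qed.

Lemma measurable_disc n (r : \bar R) : measurable (disc r : set 'rV[R]_n).
Proof. by apply: closed_measurable_rV; exact: closed_disc. Qed.

Lemma measurable_sphere n r : measurable [set x : 'rV[R]_n | enorm x = r].
Proof.
apply: closed_measurable_rV.
have /continuous_closedP cn := @enorm_continuous n.
by apply: (cn [set x | x = r]); exact: closed_eq.
Qed.

(** Every line parallel to the first axis meets the sphere in at most two
    points. *)
Lemma leb_sphere n r : leb (1 + n) [set x : 'rV[R]_(1 + n) | enorm x = r] = 0%E.
Proof.
set S := [set x | _]; have mS : measurable S by exact: measurable_sphere.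
have [r0|r0] := ltP r 0.
  rewrite (_ : S = set0) ?measure0// -subset0 => x; rewrite /S/= => xr.
  by have := enorm_ge0 x; rewrite xr leNgt r0.
have mE : measurable_fun setT (fun x => (\1_S x)%:E : \bar R).
  by apply/measurable_EFinP; exact: measurable_indic.
have E0 (x : 'rV[R]_(1 + n)) : (0%:E <= (\1_S x)%:E)%E by rewrite lee_fin.
rewrite -[X in leb _ X]setIT -integral_indic// ge0_integral_leb//.
(* Exchange the integrals, so that the inner one runs along a line parallel
   to the first axis. *)
rewrite (@sfinite_Fubini _ _ _ _ R lebesgue_measure (leb n)
  (fun p => (\1_S (consV p))%:E))//=; last first.
  by apply: (measurableT_comp mE); exact: measurable_consV.
apply: integral0_eq => v _.
set s := Num.sqrt (r ^+ 2 - \sum_(i < n) v ord0 i ^+ 2).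
have SE (x : R) : S (consV (x, v)) -> [set s; - s] x.
  rewrite /S/= /enorm big_split_ord big_ord1 consV0/= => xr.
  have rE : r ^+ 2 - \sum_(i < n) v ord0 i ^+ 2 = x ^+ 2.
    rewrite -xr sqr_sqrtr; last first.
      by rewrite addr_ge0 ?sqr_ge0 ?sumr_ge0// => i _; exact: sqr_ge0.
    under eq_bigr do rewrite consVS.
    by rewrite addrK.
  have xs : x ^+ 2 = s ^+ 2 by rewrite sqr_sqrtr ?rE// sqr_ge0.
  by move/eqP: xs; rewrite eqf_sqr => /orP[] /eqP ->; [left|right].
have cA : countable [set x : R | S (consV (x, v))].
  apply: (sub_countable (B := [set s; - s])); first exact: subset_card_le.
  by apply: finite_set_countable; exact: finite_set2.
transitivity (\int[lebesgue_measure]_x (\1_[set x : R | S (consV (x, v))] x)%:E)%E.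
  by apply: eq_integral => x _; rewrite !indicE.
rewrite integral_indic ?setIT//; first exact: countable_lebesgue_measure0.
exact: countable_measurable (@measurable_set1 R) cA.
Qed.
End Disc.

(** * Step functions on grids *)

Section Integrability.
Context d (T : measurableType d) {R : realType}
  (mu : {measure set T -> \bar R}).
Implicit Types (A : set T) (f : T -> R).

Lemma integrable_indic_lty A : measurable A -> (mu A < +oo)%E ->
  mu.-integrable setT (fun x => (\1_A x)%:E).
Proof.
move=> mA Aoo; apply/integrableP; split.
  by apply/measurable_EFinP; exact: measurable_indic.
rewrite (eq_integral (fun x => (\1_A x)%:E)); last first.
  by move=> x _; rewrite /= ger0_norm.
by rewrite integral_indic// setIT.
Qed.

Lemma integrable_bounded_support A f M : measurable A -> (mu A < +oo)%E ->
  measurable_fun setT f -> (forall x, `|f x| <= M * \1_A x) ->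
  mu.-integrable setT (fun x => (f x)%:E).
Proof.
move=> mA Aoo mf fM.
apply: (@le_integrable _ _ _ _ _ measurableT _ (fun x => M%:E * (\1_A x)%:E)%E).
- exact/measurable_EFinP.
- by move=> x _; rewrite -EFinM lee_fin (le_trans (fM x))// ler_norm.
- by apply: integrableZl => //; exact: integrable_indic_lty.
Qed.

End Integrability.

Section StepFunctions.
Context {R : realType} {n : nat}.
Implicit Types (t : 'I_n -> nat -> R) (g h : 'rV[R]_n -> R) (rho M : R).

(** Half-open cells partition the half-open cube, whereas the closed cells of
    a grid overlap; a function constant on each cell needs the former. *)
Definition hcell N t (k : {ffun 'I_n -> 'I_N}) : rectangle (R := R) (n := n) :=
  fun i => `]t i (k i), t i (k i).+1].

Definition hcube rho : rectangle (R := R) (n := n) := fun=> `](- rho), rho].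

(** With c k the infimum of h over the closed cell k, the integral of this
    function is the lower sum of h. *)
Definition step N t (c : {ffun 'I_n -> 'I_N} -> R) (x : 'rV[R]_n) : R :=
  \sum_k c k * \1_(rect_set (hcell t k)) x.

Lemma leb_hcube rho : (leb n (rect_set (hcube rho)) < +oo)%E.
Proof.
rewrite -ge0_fin_numE ?measure_ge0// leb_rect_set.
by apply: prode_fin_num => i _; rewrite /itv_length; case: ifPn.
Qed.

Lemma grid_homo rho N t i : grid rho N t ->
  forall j k, (j <= k <= N)%N -> t i j <= t i k.
Proof.
move=> /(_ i)[_ _ ti] j k; elim: k => [|k IH].
  by rewrite leqn0 => /andP[/eqP->].
rewrite leq_eqVlt => /andP[/orP[/eqP->//|jk] kN].
by rewrite (le_trans (IH _)) ?ti// -ltnS jk ltnW.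
Qed.

Lemma hcell_sub_cell N t k : rect_set (hcell (N := N) t k) `<=` cell t k.
Proof. by move=> x H i; have := H i; rewrite in_itv/= => /andP[/ltW-> ->]. Qed.

Lemma hcell_sub_hcube rho N t k : grid rho N t ->
  rect_set (hcell (N := N) t k) `<=` rect_set (hcube rho).
Proof.
move=> gt x H i; have := H i; rewrite !in_itv/= => /andP[x1 x2].
have [t0 tN _] := gt i; rewrite -t0 -[X in _ <= X]tN; apply/andP; split.
  by rewrite (le_lt_trans _ x1)//; apply: (grid_homo i gt); rewrite leq0n/= ltnW.
by rewrite (le_trans x2)//; apply: (grid_homo i gt); rewrite leqnn andbT.
Qed.

Lemma hcell_inj rho N t (k l : {ffun 'I_n -> 'I_N}) x : grid rho N t ->
  rect_set (hcell t k) x -> rect_set (hcell t l) x -> k = l.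
Proof.
move=> gt kx lx; apply/ffunP => i; apply: val_inj => /=.
have := kx i; have := lx i; rewrite !in_itv/= => /andP[l1 l2] /andP[k1 k2].
have [lt_kl|lt_lk|//] := ltngtP (k i) (l i).
  have := grid_homo i gt (j := (k i).+1) (k := l i).
  by rewrite lt_kl ltnW// => /(_ isT); rewrite leNgt (lt_le_trans l1 k2).
have := grid_homo i gt (j := (l i).+1) (k := k i).
by rewrite lt_lk ltnW// => /(_ isT); rewrite leNgt (lt_le_trans k1 l2).
Qed.

Lemma hcell_cover rho N t x : grid rho N t -> rect_set (hcube rho) x ->
  exists k : {ffun 'I_n -> 'I_N}, rect_set (hcell t k) x.
Proof.
move=> gt xc.
have H i : {k : 'I_N | t i k < x ord0 i <= t i k.+1}.
  apply: cid; have := xc i; rewrite in_itv/= => /andP[x0 xr].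
  have [t0 tN _] := gt i.
  have ex : exists k, (x ord0 i <= t i k)%R by exists N; rewrite tN.
  have mN : (ex_minn ex <= N)%N by case: ex_minnP => m _; apply; rewrite tN.
  case: ex_minnP mN => -[|m]; first by rewrite t0 leNgt x0.
  move=> xm mmin mN; exists (Ordinal mN) => /=; rewrite xm andbT ltNge.
  by apply/negP => /mmin; rewrite ltnn.
exists [ffun i => sval (H i)] => i; rewrite in_itv/= ffunE.
by case: (H i).
Qed.

Lemma step_in rho N t c k x : grid rho N t ->
  rect_set (hcell t k) x -> step (N := N) t c x = c k.
Proof.
move=> gt kx; rewrite /step (bigD1 k)//= big1 ?addr0.
  by rewrite indicE mem_set// mulr1.
move=> l lk; rewrite indicE memNset ?mulr0// => lx.
by move/eqP: lk; apply; apply: hcell_inj gt lx kx.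
Qed.

Lemma step_out rho N t c x : grid rho N t ->
  ~ rect_set (hcube rho) x -> step (N := N) t c x = 0.
Proof.
move=> gt xc; rewrite /step big1// => l _.
by rewrite indicE memNset ?mulr0// => /(hcell_sub_hcube gt).
Qed.

Lemma step_bound rho N t c M x : grid rho N t -> (forall k, `|c k| <= M) ->
  `|step (N := N) t c x| <= M * \1_(rect_set (hcube rho)) x.
Proof.
move=> gt cM; have [xc|xc] := pselect (rect_set (hcube rho) x); last first.
  by rewrite (step_out _ gt)// indicE memNset// normr0 mulr0.
have [k kx] := hcell_cover gt xc.
by rewrite (step_in _ gt kx) indicE mem_set// mulr1.
Qed.

Lemma measurable_step N t c : measurable_fun setT (step (N := N) t c).
Proof.
apply: measurable_sum => k; apply: measurable_funM => //.
by apply: measurable_indic; exact: measurable_rect_set.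
Qed.

Lemma leb_hcell rho N t (k : {ffun 'I_n -> 'I_N}) : grid rho N t ->
  leb n (rect_set (hcell t k)) = (cell_volume t k)%:E.
Proof.
move=> gt; rewrite leb_rect_set /rect_L /cell_volume -prodEFin.
apply: eq_bigr => i _; rewrite /itv_length/= lte_fin.
have [_ _ /(_ (k i) (ltn_ord _))] := gt i.
rewrite le_eqVlt => /orP[/eqP->|->]; last by rewrite EFinB.
by rewrite ltxx subrr.
Qed.

Lemma integral_step rho N t c : grid rho N t ->
  (\int[leb n]_x (step (N := N) t c x)%:E = (\sum_k c k * cell_volume t k)%:E)%E.
Proof.
move=> gt.
pose C k := rect_set (hcell (N := N) t k).
have ih k : (leb n).-integrable setT (fun x => (\1_(C k) x)%:E).
  apply: integrable_indic_lty; first exact: measurable_rect_set.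
  by rewrite [X in (X < _)%E](leb_hcell _ gt) ltry.
rewrite (eq_integral (fun x => \sum_k ((c k)%:E * (\1_(C k) x)%:E)%E)); last first.
  by move=> x _; rewrite /step -sumEFin.
rewrite integral_sum//; last by move=> k; apply: integrableZl.
rewrite -sumEFin; apply: eq_bigr => k _.
rewrite integralZl// integral_indic ?setIT//; last exact: measurable_rect_set.
by rewrite [X in (_ * X)%E](leb_hcell _ gt).
Qed.

Lemma integrable_step rho N t c : grid rho N t ->
  (leb n).-integrable setT (fun x => (step (N := N) t c x)%:E).
Proof.
move=> gt; apply: (@integrable_bounded_support _ _ _ _ (rect_set (hcube rho)) _
  (\sum_k `|c k|)).
- exact: measurable_rect_set.
- exact: leb_hcube.
- exact: measurable_step.
- move=> x; apply: step_bound => // k.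
  by rewrite (bigD1 k)//= lerDl sumr_ge0.
Qed.

End StepFunctions.

(** * Riemann integrals over discs *)

Section Riemann.
Context {R : realType} {n : nat} (n_gt0 : (0 < n)%N).
Implicit Types (t : 'I_n -> nat -> R) (g h : 'rV[R]_n -> R).

Lemma leb_disc_lty (r : R) : (leb n (disc r%:E) < +oo)%E.
Proof.
apply: le_lt_trans (leb_hcube (n := n) (r + 1)).
apply: le_measure; rewrite ?inE.
- exact: measurable_disc.
- exact: measurable_rect_set.
- move=> x; rewrite discE /= => xr i; rewrite in_itv/=.
  by have := le_trans (coord_le_enorm x i) xr; rewrite ler_norml => /andP[]; lra.
Qed.

Lemma leb_sphere0 (r : R) : leb n [set x : 'rV[R]_n | enorm x = r] = 0%E.
Proof. by case: n n_gt0 => // n' _; exact: (leb_sphere n'). Qed.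

Lemma lower_sum_oppE N t h :
  lower_sum N t (fun x => - h x) = - upper_sum N t h.
Proof.
rewrite /lower_sum /upper_sum -sumrN; apply: eq_bigr => k _.
rewrite -mulNr; congr (_ * _); rewrite /inf; congr (- sup _).
apply/seteqP; split=> y /=.
  by move=> [_ [x xk <-] <-]; exists x => //; rewrite opprK.
by move=> [x xk <-]; exists (- h x); [exists x|rewrite opprK].
Qed.

Section BoundedContinuous.
Variables (rho M : R).
Hypothesis rho_gt0 : 0 < rho.
Let M1 x := M * \1_(disc rho%:E : set 'rV[R]_n) x.

(** The extension by 0 that enters the Darboux sums over a disc. *)
Definition cutoff g (x : 'rV[R]_n) := g x * \1_(disc rho%:E) x.

Lemma cutoff_bound g x : (forall x, `|g x| <= M) -> `|cutoff g x| <= M1 x.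
Proof.
by move=> gM; rewrite /cutoff normrM ler_pM// indicE ger0_norm.
Qed.

Lemma cutoff_le g x : (forall x, `|g x| <= M) -> `|cutoff g x| <= M.
Proof.
move=> gM; rewrite /cutoff normrM (le_trans _ (gM x))// ler_piMr//.
by rewrite indicE; case: (_ \in _); rewrite normr_nat.
Qed.

Lemma cutoffN g : cutoff (fun x => - g x) = (fun x => - cutoff g x).
Proof. by apply/funext => x; rewrite /cutoff mulNr. Qed.

Lemma measurable_cutoff g : measurable_fun setT g -> measurable_fun setT (cutoff g).
Proof.
move=> mg; apply: measurable_funM => //.
by apply: measurable_indic; exact: measurable_disc.
Qed.

Lemma integrable_cutoff g : measurable_fun setT g -> (forall x, `|g x| <= M) ->
  (leb n).-integrable setT (fun x => (cutoff g x)%:E).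
Proof.
move=> mg gM; apply: (integrable_bounded_support (A := disc rho%:E) (M := M)).
- exact: measurable_disc.
- exact: leb_disc_lty.
- exact: measurable_cutoff.
- by move=> x; exact: cutoff_bound.
Qed.

Lemma integral_cutoff g : (\int[leb n]_x (cutoff g x)%:E =
  \int[leb n]_(x in disc rho%:E) (g x)%:E)%E.
Proof.
rewrite [RHS]integral_mkcond; apply: eq_integral => x _.
rewrite /cutoff patchE indicE; case: ifPn => _; first by rewrite mulr1.
by rewrite mulr0.
Qed.

(** The half-open cube misses some points of the disc, but all of them are
    tangency points on the sphere. *)
Lemma cutoff_out g x : ~ rect_set (hcube rho) x -> enorm x <> rho -> cutoff g x = 0.
Proof.
move=> xc xr; rewrite /cutoff indicE memNset ?mulr0//.
rewrite discE /= => xle; apply: xc => i; rewrite in_itv/=.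
have := le_trans (coord_le_enorm x i) xle.
rewrite ler_norml => /andP[x1 ->]; rewrite andbT lt_neqAle x1 andbT.
apply/eqP => xE; apply: xr; apply/eqP; rewrite eq_le xle/=.
by rewrite (le_trans _ (coord_le_enorm x i))// -xE normrN gtr0_norm.
Qed.

Lemma image_lbound g (C : set 'rV[R]_n) : (forall x, `|g x| <= M) ->
  has_lbound (g @` C).
Proof.
move=> gM; exists (- M) => _ [x _ <-].
by have := gM x; rewrite ler_norml => /andP[].
Qed.

Lemma inf_cell_bound g N (t : 'I_n -> nat -> R) k : (forall x, `|g x| <= M) ->
  rect_set (hcell (N := N) t k) !=set0 -> `|inf (g @` cell t k)| <= M.
Proof.
move=> gM [x /hcell_sub_cell xk]; rewrite ler_norml; apply/andP; split.
  apply: lb_le_inf; first by exists (g x), x.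
  by move=> _ [y _ <-]; have := gM y; rewrite ler_norml => /andP[].
apply: le_trans (_ : g x <= M); last by have := gM x; rewrite ler_norml => /andP[].
by apply: ge_inf; [exact: image_lbound|exists x].
Qed.

(** The step function of a lower sum lies below the integrand at every point
    off the sphere. *)
Lemma lower_sum_le g N t : measurable_fun setT g -> (forall x, `|g x| <= M) ->
  grid rho N t ->
  ((lower_sum N t (cutoff g))%:E <= \int[leb n]_x (cutoff g x)%:E)%E.
Proof.
move=> mg gM gt; rewrite /lower_sum -(integral_step _ gt).
have cM x := cutoff_le x gM.
have mS := measurable_sphere (R := R) (n := n) rho; have S0 := leb_sphere0 rho.
rewrite (negligible_integral mS _ _ S0)//; last exact: integrable_step gt.
rewrite [leRHS](negligible_integral mS _ _ S0)//; last exact: integrable_cutoff.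
have mD : measurable (setT `\` [set x : 'rV[R]_n | enorm x = rho]).
  exact: measurableD.
apply: le_integral => //.
- by apply: integrableS (integrable_step _ gt).
- by apply: integrableS (integrable_cutoff mg gM).
- move=> x; rewrite inE => -[_ /= xr]; rewrite lee_fin.
  have [xc|xc] := pselect (rect_set (hcube rho) x); last first.
    by rewrite (step_out _ gt)// cutoff_out.
  have [k kx] := hcell_cover gt xc; rewrite (step_in _ gt kx).
  apply: ge_inf; first exact: image_lbound.
  by exists x => //; exact: hcell_sub_cell.
Qed.

Definition ugrid m : 'I_n -> nat -> R :=
  fun _ k => - rho + (rho *+ 2 / m.+1%:R) * k%:R.

Lemma ugrid_grid m : grid rho m.+1 (ugrid m).
Proof.
move=> i; rewrite /ugrid; split=> [||k _].
- by rewrite mulr0 addr0.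
- by rewrite divfK ?pnatr_eq0//; lra.
- by rewrite lerD2l ler_wpM2l ?ler_nat// divr_ge0// mulrn_wge0// ltW.
Qed.

Lemma cutoff_continuous_off g x : continuous g -> enorm x <> rho ->
  {for x, continuous (cutoff g)}.
Proof.
move=> cg /eqP; rewrite neq_lt => /orP[xr|xr].
- have U : \forall y \near x, g y = cutoff g y.
    have : \forall y \near x, enorm y < rho.
      by have := @enorm_continuous R n x _ (lt_nbhsl xr).
    apply: filterS => y yr; rewrite /cutoff indicE mem_set ?mulr1//.
    by rewrite discE/= ltW.
  have gx : g x = cutoff g x := nbhs_singleton U.
  by rewrite /prop_for /continuous_at -gx; exact: cvg_trans (near_eq_cvg U) (cg x).
- have U : \forall y \near x, 0 = cutoff g y.
    have : \forall y \near x, rho < enorm y.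
      by have := @enorm_continuous R n x _ (lt_nbhsr xr).
    apply: filterS => y yr; rewrite /cutoff indicE memNset ?mulr0//.
    by rewrite discE/= leNgt yr.
  have gx : 0 = cutoff g x := nbhs_singleton U.
  rewrite /prop_for /continuous_at -gx.
  exact: cvg_trans (near_eq_cvg U) (cvg_cst _).
Qed.


(** The integrand is continuous off the sphere, and the cell of the m-th
    uniform grid that contains x shrinks to x. *)
Lemma lower_step_cvg g x : continuous g -> (forall x, `|g x| <= M) ->
  enorm x <> rho ->
  step (ugrid m) (fun k : {ffun 'I_n -> 'I_m.+1} =>
    inf (cutoff g @` cell (ugrid m) k)) x @[m --> \oo] --> cutoff g x.
Proof.
move=> cg gM xr; have cM y := cutoff_le y gM.
have [xc|xc] := pselect (rect_set (hcube rho) x); last first.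
  rewrite (cutoff_out g xc xr); apply: cvg_near_cst; apply: nearW => m.
  by rewrite (step_out _ (ugrid_grid m)).
apply/cvgrPdist_le => e e0.
have /cvgrPdist_le/(_ _ e0)/nbhs_ballP[d /= d0 de] := cutoff_continuous_off cg xr.
have : \forall m \near \oo, rho *+ 2 / d < m%:R.
  exact: nbhs_infty_gtr.
apply: filterS => m md.
have [k kx] := hcell_cover (ugrid_grid m) xc.
rewrite (step_in _ (ugrid_grid m) kx).
have mesh y : cell (ugrid m) k y -> ball x d y.
  move=> yk; split=> // i j; rewrite (ord1 i).
  have := yk j; have := hcell_sub_cell kx j; rewrite /ugrid.
  have : rho *+ 2 / m.+1%:R < d.
    rewrite ltr_pdivrMr ?ltr0n// mulrC -ltr_pdivrMr//.
    by rewrite (lt_le_trans md)// ler_nat.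
  move: (_ / _) => u ud; rewrite -natr1 mulrDr mulr1.
  move: (_ * _) => v /andP[x1 x2] /andP[y1 y2].
  rewrite /ball/= ltr_distlC; apply/andP; split; lra.
have xi : cell (ugrid m) k x by exact: hcell_sub_cell.
have hi y : cell (ugrid m) k y -> cutoff g x - e <= cutoff g y.
  by move=> /mesh/de; rewrite ler_distl => /andP[]; lra.
rewrite ger0_norm ?subr_ge0; last first.
  by apply: ge_inf; [exact: image_lbound cM|exists x].
rewrite lerBlDr -lerBlDl; apply: lb_le_inf; first by exists (cutoff g x), x.
by move=> _ [y yk <-]; exact: hi.
Qed.

(** Dominated convergence for the step functions, the sphere being null. *)
Lemma lower_sum_cvg g : continuous g -> (forall x, `|g x| <= M) ->
  ((lower_sum m.+1 (ugrid m) (cutoff g))%:E @[m --> \oo] -->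
    \int[leb n]_x (cutoff g x)%:E)%E.
Proof.
move=> cg gM; have cM y := cutoff_le y gM.
have mg := continuous_measurable_rV cg.
pose S m := step (ugrid m) (fun k : {ffun 'I_n -> 'I_m.+1} =>
    inf (cutoff g @` cell (ugrid m) k)).
have [] := @dominated_convergence _ _ _ (leb n) setT measurableT
  (fun m x => (S m x)%:E) (fun x => (cutoff g x)%:E)
  (fun x => (M * \1_(rect_set (hcube rho)) x)%:E).
- by move=> m; apply/measurable_EFinP; exact: measurable_step.
- by apply/measurable_EFinP; exact: measurable_cutoff.
- exists [set x | enorm x = rho]; split.
  + exact: measurable_sphere.
  + exact: leb_sphere0.
  + move=> x /= xS; apply: contrapT => xr; apply: xS => _.
    apply: cvg_EFin; first exact: nearW.
    exact: lower_step_cvg.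
- apply: (@integrable_bounded_support _ _ _ _ (rect_set (hcube rho)) _ M).
  + exact: measurable_rect_set.
  + exact: leb_hcube.
  + apply: measurable_funM => //; apply: measurable_indic.
    exact: measurable_rect_set.
  + move=> x; rewrite ger0_norm// mulr_ge0// ?indicE//.
    exact: le_trans (normr_ge0 _) (gM x).
- apply: aeW => x m _; rewrite lee_fin.
  have [xc|xc] := pselect (rect_set (hcube rho) x); last first.
    by rewrite /S (step_out _ (ugrid_grid m))// indicE memNset// normr0 mulr0.
  have [k kx] := hcell_cover (ugrid_grid m) xc.
  rewrite /S (step_in _ (ugrid_grid m) kx) indicE mem_set// mulr1.
  by apply: inf_cell_bound => //; exists x.
move=> _ _; apply: cvg_trans; apply: near_eq_cvg; apply: nearW => m.
by rewrite /S /= (integral_step _ (ugrid_grid m)).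
Qed.

Let J g : R := fine (\int[leb n]_x (cutoff g x)%:E)%E.

Lemma sup_lower_sum g : continuous g -> (forall x, `|g x| <= M) ->
  sup [set s | exists N t, grid rho N t /\ s = lower_sum N t (cutoff g)] = J g.
Proof.
move=> cg gM; have mg := continuous_measurable_rV cg.
have JE : ((J g)%:E = \int[leb n]_x (cutoff g x)%:E)%E.
  by rewrite fineK//; exact/integrable_fin_num/integrable_cutoff.
set L := [set s | _].
have LJ : ubound L (J g).
  by move=> _ [N [t [gt ->]]]; rewrite -lee_fin JE; exact: lower_sum_le.
have Lm m : L (lower_sum m.+1 (ugrid m) (cutoff g)).
  by exists m.+1, (ugrid m); split => //; exact: ugrid_grid.
apply/eqP; rewrite eq_le; apply/andP; split.
  by apply: ge_sup => //; exists (lower_sum 1 (ugrid 0) (cutoff g)).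
rewrite -lee_fin JE.
have LC := lower_sum_cvg cg gM.
apply: (lee_cvg_to LC (cvg_cst _)).
apply: nearW => m; rewrite lee_fin; apply: sup_upper_bound => //.
by split; [exists (lower_sum 1 (ugrid 0) (cutoff g))|exists (J g)].
Qed.

(** Upper sums are opposites of the lower sums of - g, so the statement on
    suprema of lower sums settles both halves. *)
Lemma is_riemann_integralE g r : continuous g -> (forall x, `|g x| <= M) ->
  is_riemann_integral rho g r <->
  r = fine (\int[leb n]_(x in disc rho%:E) (g x)%:E)%E.
Proof.
move=> cg gM; rewrite -integral_cutoff -/(J g).
have sE := sup_lower_sum cg gM.
split=> [[<- _]|->]; first by rewrite -sE.
split; first exact: sE.
have cNg : continuous (fun x => - g x).
  by move=> x; apply: continuousN; exact: cg.
have NgM x : `|- g x| <= M by rewrite normrN.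
have := sup_lower_sum cNg NgM.
have ig := integrable_cutoff (continuous_measurable_rV cg) gM.
rewrite /J cutoffN (eq_integral (fun x => - (cutoff g x)%:E)%E)//.
rewrite integralN ?integrable_add_def//.
rewrite fineN => sNE; rewrite /inf -[RHS]opprK -sNE; congr (- sup _).
apply/seteqP; split=> y /=.
  move=> [_ [N [t [gt ->]]] <-]; exists N, t; split => //.
  by rewrite lower_sum_oppE.
move=> [N [t [gt ->]]]; rewrite lower_sum_oppE.
by exists (upper_sum N t (cutoff g)) => //; exists N, t.
Qed.

End BoundedContinuous.
End Riemann.

(** * Borel versions of quasicontinuous functions *)

Section Version.
Context {R : realType} {n : nat}.
Implicit Types (f : 'rV[R]_n -> option R) (g : 'rV[R]_n -> R).

Lemma measurable_mrect_set (Delta : multirectangle (R := R) (n := n)) :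
  measurable (mrect_set Delta).
Proof. by apply: bigcup_measurable => j _; exact: measurable_rect_set. Qed.

Lemma leb_mrect_set (Delta : multirectangle (R := R) (n := n)) :
  (leb n (mrect_set Delta) <= mrect_L Delta)%E.
Proof.
rewrite /mrect_L (eq_eseriesr (g := fun j => leb n (rect_set (Delta j)))).
  apply: measure_sigma_subadditive => //.
  - by move=> j; exact: measurable_rect_set.
  - exact: measurable_mrect_set.
by move=> j _; rewrite leb_rect_set.
Qed.

(** A Borel representative g of f; it carries f into the Lebesgue theory. *)
Definition version f g := measurable_fun setT g /\
  exists N, [/\ measurable N, leb n N = 0%E & forall x, ~ N x -> f x = Some (g x)].

Lemma continuous_off_setT f e (Delta : multirectangle) :
  continuous_off +oo f e Delta ->
  {within ~` mrect_set Delta, continuous (pval f)}.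
Proof. by move=> [_ _ _]; rewrite disc_pinfty setTD. Qed.

(** f is continuous on each closed set ~` U_j, hence Borel on their union, and
    the complement of that union has measure at most 1 / (j + 1) for all j. *)
Lemma quasicontinuous_version f : quasicontinuous +oo f -> exists g, version f g.
Proof.
move=> [_ fq].
have e_gt0 j : 0 < j.+1%:R^-1 :> R by rewrite invr_gt0.
have [Delta DeltaP] := choice (fun j => fq _ (e_gt0 j)).
pose U j := mrect_set (Delta j); pose N := \bigcap_j U j.
have oU j : open (U j) by have [] := DeltaP j.
have mU j : measurable (U j) by exact: measurable_mrect_set.
have mN : measurable N by exact: bigcap_measurable.
exists (pval f \_ (~` N)); split.
  apply/(measurable_restrictT _ (measurableC mN)).
  rewrite setC_bigcap; apply/measurable_fun_bigcup => j; first exact: measurableC.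
  apply: continuous_within_measurable; first exact: open_closedC.
  exact: continuous_off_setT (DeltaP j).
exists N; split => // [|x Nx].
  apply/eqP; rewrite -measure_le0; apply/lee_addgt0Pr => e e0; rewrite add0e.
  have [j] : exists j, j.+1%:R^-1 < e.
    have [j _ /(_ j (leqnn _)) ?] := near_infty_natSinv_lt (PosNum e0).
    by exists j.
  move=> je; apply: le_trans (_ : leb n (U j) <= _)%E.
    by apply: le_measure; rewrite ?inE//; exact: bigcap_inf.
  apply: le_trans (leb_mrect_set _) _; have [Le _ _ _] := DeltaP j.
  by apply: le_trans (ltW Le) _; rewrite lee_fin ltW.
rewrite patchE mem_set// /pval.
have [j Uj] : exists j, ~ U j x by apply/existsNP => H; apply: Nx => j _; exact: H.
have [_ _ /(_ x) dx _] := DeltaP j.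
case E : (f x) => [//|]; exfalso; apply: dx E.
by rewrite disc_pinfty; split.
Qed.

End Version.

(** * The integral of bounded functions *)

(** A bounded Tietze extension, clipped between the infimum and the supremum
    of f on A. For an empty A no extension can have the infimum +oo, hence the
    assumption. *)
Lemma tietze_same_range (R : realType) (T : pseudoMetricType R) (A : set T)
    (f : T -> R) (M : R) : closed A -> A !=set0 ->
  {within A, continuous f} -> (forall x, A x -> `|f x| <= M) ->
  exists g : T -> R, [/\ continuous g, forall x, A x -> g x = f x,
    ereal_inf [set (g x)%:E | x in setT] = ereal_inf [set (f x)%:E | x in A] &
    ereal_sup [set (g x)%:E | x in setT] = ereal_sup [set (f x)%:E | x in A]].
Proof.
move=> cA [x0 Ax0] cf fM.
have M0 : 0 <= M by exact: le_trans (normr_ge0 _) (fM _ Ax0).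
have M1 : 0 < M + 1 by rewrite ltr_wpDl.
have fM1 x : A x -> `|f x| <= M + 1 by move=> /fM/le_trans; apply; rewrite lerDl.
have [g [gf cg _]] := continuous_bounded_extension pseudometric_normal cA M1 cf fM1.
pose S := f @` A.
have S0 : S !=set0 by exists (f x0), x0.
have lS : has_lbound S.
  by exists (- M) => _ [x Ax <-]; have := fM x Ax; rewrite ler_norml => /andP[].
have uS : has_ubound S.
  by exists M => _ [x Ax <-]; have := fM x Ax; rewrite ler_norml => /andP[].
have fi x : A x -> inf S <= f x by move=> Ax; apply: ge_inf => //; exists x.
have fs x : A x -> f x <= sup S by move=> Ax; apply: ub_le_sup => //; exists x.
pose h := ((g : T -> R) \max cst (inf S)) \min cst (sup S).
have hf x : A x -> h x = f x.
  move=> Ax; rewrite /h /= -gf ?inE//.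
  by rewrite max_l ?fi// min_l ?fs.
have infE : ereal_inf [set (f x)%:E | x in A] = (inf S)%:E.
  rewrite -ereal_inf_EFin//; congr ereal_inf.
  by rewrite /S -image_comp.
have supE : ereal_sup [set (f x)%:E | x in A] = (sup S)%:E.
  rewrite -ereal_sup_EFin//; congr ereal_sup.
  by rewrite /S -image_comp.
have sub : [set (f x)%:E | x in A] `<=` [set (h x)%:E | x in setT].
  by move=> _ [x Ax <-]; exists x => //; rewrite hf.
have infsup : inf S <= sup S := le_trans (fi _ Ax0) (fs _ Ax0).
exists h; split => //.
- apply: min_fun_continuous; last by move=> x; exact: cvg_cst.
  by apply: max_fun_continuous => // x; exact: cvg_cst.
- apply/eqP; rewrite eq_le; apply/andP; split; first exact: ereal_inf_le_tmp.
  rewrite infE; apply/ereal_infP => _ [x _ <-].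
  by rewrite lee_fin /h/= le_min le_max lexx orbT.
- apply/eqP; rewrite eq_le; apply/andP; split; last exact: ereal_sup_le.
  rewrite supE; apply/ereal_supP => _ [x _ <-].
  by rewrite lee_fin /h/= ge_min lexx orbT.
Qed.

Section BoundedIntegral.
Context {R : realType} {n : nat} (n_gt0 : (0 < n)%N).
Variables (f : 'rV[R]_n -> option R) (g : 'rV[R]_n -> R) (rho M : R).
Hypotheses (rho_gt0 : 0 < rho) (fq : quasicontinuous +oo f) (fg : version f g).
Hypotheses (fM : forall x, `|pval f x| <= M) (gM : forall x, `|g x| <= M).

(** Multirectangles of total length below this measure cannot cover the disc,
    so that [tietze_same_range] applies. *)
Lemma leb_disc_gt0 : (0 < leb n (disc rho%:E))%E.
Proof.
(* The cube of half-side rho / n is contained in the disc. *)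
pose s := rho / n%:R.
have n0 : 0 < n%:R :> R by rewrite ltr0n.
have s0 : 0 < s by rewrite divr_gt0.
apply: lt_le_trans (_ : leb n (rect_set (hcube s)) <= _)%E.
  rewrite leb_rect_set /rect_L (eq_bigr (fun=> (s *+ 2)%:E)); last first.
    move=> i _; rewrite /itv_length/= lte_fin gtrN// -EFinB.
    by congr EFin; lra.
  by rewrite prodEFin lte_fin prodr_gt0// => i _; rewrite pmulrn_lgt0.
apply: le_measure; rewrite ?inE.
- exact: measurable_rect_set.
- exact: measurable_disc.
- move=> x xs; rewrite discE/= -[leRHS](gtr0_norm rho_gt0) -sqrtr_sqr.
  rewrite ler_sqrt ?sqr_ge0//.
  apply: (@le_trans _ _ (\sum_(i < n) s ^+ 2)).
    apply: ler_sum => i _; rewrite -[leLHS]real_normK ?num_real//.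
    rewrite lerXn2r ?nnegrE ?(ltW s0)// ler_norml.
    by have := xs i; rewrite in_itv/= => /andP[/ltW -> ->].
  have sn : rho = s * n%:R by rewrite divfK ?gt_eqF.
  rewrite sumr_const card_ord -mulr_natr [in leRHS]sn [leRHS]exprMn.
  by rewrite ler_wpM2l ?sqr_ge0// -natrX ler_nat expnS expn1 leq_pmulr.
Qed.

Lemma continuous_off_disc e (Delta : multirectangle) :
  continuous_off +oo f e Delta -> continuous_off rho%:E f e Delta.
Proof.
rewrite /continuous_off disc_pinfty => -[Le oU df cf]; split => //.
- by move=> x [_ xU]; exact: df.
- by apply: continuous_subspaceW cf => x [_ xU].
Qed.

Lemma extension_bound Delta G :
  is_extension rho%:E f Delta G -> forall x, `|G x| <= M.
Proof.
move=> [_ _ iE sE] x; rewrite ler_norml; apply/andP; split; rewrite -lee_fin.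
  have : (ereal_inf [set (G x)%:E | x in setT] <= (G x)%:E)%E.
    by apply: ereal_inf_lbound; exists x.
  apply: le_trans; rewrite iE; apply/ereal_infP => _ [y _ <-].
  by rewrite lee_fin; have := fM y; rewrite ler_norml => /andP[].
have : ((G x)%:E <= ereal_sup [set (G x)%:E | x in setT])%E.
  by apply: ereal_sup_ubound; exists x.
move=> /le_trans; apply; rewrite sE; apply/ereal_supP => _ [y _ <-].
by rewrite lee_fin; have := fM y; rewrite ler_norml => /andP[].
Qed.

Let J (h : 'rV[R]_n -> R) : R := fine (\int[leb n]_(x in disc rho%:E) (h x)%:E)%E.

Lemma integrable_disc (h : 'rV[R]_n -> R) : measurable_fun setT h ->
  (forall x, `|h x| <= M) -> (leb n).-integrable (disc rho%:E) (EFin \o h).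
Proof.
move=> mh hM; have := integrable_cutoff rho mh hM.
move=> /(integrableS measurableT (measurable_disc _) (@subsetT _ (disc rho%:E))).
apply: eq_integrable => //; first exact: measurable_disc.
by move=> x xD; rewrite /cutoff indicE xD mulr1.
Qed.

(** On the disc G and g are bounded by M and agree off I_Delta, up to a null
    set. *)
Lemma extension_integral_dist e Delta G :
  continuous_off rho%:E f e Delta -> is_extension rho%:E f Delta G ->
  `|J G - J g| <= M *+ 2 * e.
Proof.
move=> [Le _ df _] ext.
have GM := extension_bound ext; have [cG GE _ _] := ext.
have mG := continuous_measurable_rV cG.
have [mg [N [mN N0 fN]]] := fg.
have mD := measurable_disc (R := R) (n := n) rho%:E.
have iG := integrable_disc mG GM; have ig := integrable_disc mg gM.
pose U := mrect_set Delta `|` N.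
have mU : measurable U by apply: measurableU => //; exact: measurable_mrect_set.
have LU : (leb n U <= e%:E)%E.
  apply: (le_trans (measureU2 _ _ _)) => //; first exact: measurable_mrect_set.
  by rewrite [X in (_ + X)%E]N0 adde0 (le_trans (leb_mrect_set _))// ltW.
have M0 : 0 <= M := le_trans (normr_ge0 _) (gM 0).
have dG x : (disc rho%:E : set 'rV[R]_n) x -> `|G x - g x| <= M *+ 2 * \1_U x.
  move=> Dx; rewrite indicE; have [Ux|Ux] := boolP (x \in U).
    by rewrite mulr1 (le_trans (ler_normB _ _))// mulr2n lerD.
  have [Dlx Nx] : ~ mrect_set Delta x /\ ~ N x.
    by move: Ux; rewrite notin_setE /U => /not_orP.
  by rewrite GE// /pval (fN _ Nx)/= subrr normr0 mulr0.
have fJ (h : 'rV[R]_n -> R) : (leb n).-integrable (disc rho%:E) (EFin \o h) ->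
    ((J h)%:E = \int[leb n]_(x in disc rho%:E) (h x)%:E)%E.
  by move=> ih; rewrite fineK//; exact: integrable_fin_num.
rewrite -lee_fin.
have -> : (`|J G - J g|%:E =
    `|\int[leb n]_(x in disc rho%:E) ((G x)%:E - (g x)%:E)|)%E.
  by rewrite integralB// -!fJ.
apply: le_trans (le_abse_integral _ mD _) _.
  by apply: measurable_funTS; apply: emeasurable_funB; exact/measurable_EFinP.
apply: (@le_trans _ _
  (\int[leb n]_(x in disc rho%:E) ((M *+ 2)%:E * (\1_U x)%:E))%E).
  apply: (ge0_le_integral _ mD) => [x _|||x Dx]; first exact: abse_ge0.
  - apply: measurable_funTS; apply: measurableT_comp => //.
    by apply: emeasurable_funB; exact/measurable_EFinP.
  - apply: measurable_funTS; apply: emeasurable_funM => //.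
    by apply/measurable_EFinP; exact: measurable_indic.
  - by rewrite -EFinB -EFinM lee_fin; exact: dG.
have mI : measurable_fun (disc rho%:E) (fun x => (\1_U x)%:E : \bar R).
  by apply: measurable_funTS; apply/measurable_EFinP; exact: measurable_indic.
have M2 : (0 <= (M *+ 2)%:E)%E by rewrite lee_fin mulrn_wge0.
rewrite (ge0_integralZl _ mD mI _ M2)//.
rewrite integral_indic// EFinM lee_wpmul2l//.
apply: le_trans LU; apply: le_measure; rewrite ?inE//; exact: measurableI.
Qed.

Lemma is_bounded_integral_unique I : is_bounded_integral rho f I -> I = J g.
Proof.
move=> [e [Delta [G [r [[e0 ecvg] off ext riem rI]]]]].
have rE j : r j = J (G j).
  have [cG _ _ _] := ext j.
  exact: (is_riemann_integralE n_gt0 rho_gt0 _ cG (extension_bound (ext j))).1.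
have := cvg_unique _ rI; apply => //.
apply/cvgrPdist_le => eps eps0.
have : M *+ 2 * e j @[j --> \oo] --> M *+ 2 * 0 by apply: cvgMr.
rewrite mulr0 => /cvgrPdist_le/(_ _ eps0); apply: filterS => j.
rewrite sub0r normrN => ej; rewrite distrC rE.
apply: le_trans (extension_integral_dist (off j) (ext j)) _.
exact: le_trans (ler_norm _) ej.
Qed.

Lemma is_bounded_integral_exists : is_bounded_integral rho f (J g).
Proof.
have D0 := leb_disc_gt0; have Doo := leb_disc_lty (n := n) rho.
pose c := fine (leb n (disc rho%:E)).
have c0 : 0 < c by rewrite fine_gt0// D0.
(* The bound c keeps I_(Delta_j) from covering the disc. *)
pose e j : R := Num.min c j.+1%:R^-1.
have e0 j : 0 < e j by rewrite lt_min c0 invr_gt0/=.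
have ecvg : e j @[j --> \oo] --> (0 : R).
  apply/cvgrPdist_le => eps eps0.
  have := near_infty_natSinv_lt (PosNum eps0); apply: filterS => j /= je.
  by rewrite sub0r normrN gtr0_norm// ge_min (ltW je) orbT.
have [_ fe] := fq.
have [Delta off0] := choice (fun j => fe _ (e0 j)).
have off j := continuous_off_disc (off0 j).
have extE j : exists G, is_extension rho%:E f (Delta j) G.
  have [Le oU df cf] := off j.
  apply: (@tietze_same_range _ _ _ _ M) => //.
  - by apply: closedI; [exact: closed_disc|exact: open_closedC].
  - apply/set0P/eqP => /= D_0.
    have : (leb n (disc rho%:E) <= leb n (mrect_set (Delta j)))%E.
      apply: le_measure; rewrite ?inE.
      - exact: measurable_disc.
      - exact: measurable_mrect_set.
      - by rewrite -setD_eq0.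
    rewrite leNgt => /negP; apply.
    apply: le_lt_trans (leb_mrect_set _) (lt_le_trans Le _).
    by rewrite -[leRHS]fineK ?ge0_fin_numE// lee_fin ge_min lexx.
have [G ext] := choice extE.
exists e, Delta, G, (fun j => J (G j)); split => //.
- move=> j; have [cG _ _ _] := ext j.
  by apply/(is_riemann_integralE n_gt0 rho_gt0 _ cG (extension_bound (ext j))).
apply/cvgrPdist_le => eps eps0.
have : M *+ 2 * e j @[j --> \oo] --> M *+ 2 * 0 by apply: cvgMr.
rewrite mulr0 => /cvgrPdist_le/(_ _ eps0); apply: filterS => j.
rewrite sub0r normrN => ej; rewrite distrC.
apply: le_trans (extension_integral_dist (off j) (ext j)) _.
exact: le_trans (ler_norm _) ej.
Qed.

Lemma bounded_integralE : bounded_integral rho f = J g.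
Proof.
apply: is_bounded_integral_unique; rewrite /bounded_integral.
by apply: getPex; exists (J g); exact: is_bounded_integral_exists.
Qed.
End BoundedIntegral.

(** * Truncations and the general integral *)

Section Truncation.
Context {R : realType} {n : nat}.
Implicit Types (f : 'rV[R]_n -> option R) (g : 'rV[R]_n -> R).

Lemma quasicontinuous_omap (phi : R -> R) f : continuous phi ->
  quasicontinuous +oo f -> quasicontinuous +oo (fun x => omap phi (f x)).
Proof.
move=> cphi [[N [nN dN]] qf]; split.
  exists N; split => // x xD Nx; have := dN x xD Nx.
  by rewrite /defined_at; case: (f x).
move=> e e0; have [Delta [Le oU df cf]] := qf e e0.
exists Delta; split => //.
  by move=> x xD; have := df x xD; rewrite /defined_at; case: (f x).
have pE x : (disc +oo `\` mrect_set Delta) x ->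
    phi (pval f x) = pval (fun x => omap phi (f x)) x.
  by move=> xD; have := df x xD; rewrite /defined_at /pval; case: (f x).
apply: (@subspace_eq_continuous _ _ _ (fun x => phi (pval f x))).
  by move=> x; rewrite inE; exact: pE.
move=> x; apply: (@continuous_comp (subspace _) _ _ (pval f) phi).
  exact: cf.
exact: cphi.
Qed.

Lemma version_omap (phi : R -> R) f g : continuous phi ->
  version f g -> version (fun x => omap phi (f x)) (fun x => phi (g x)).
Proof.
move=> cphi [mg [N [mN N0 fg]]]; split.
  apply: (measurableT_comp (f := phi) _ mg); exact: continuous_measurable_fun.
by exists N; split => // x /fg ->.
Qed.

Definition clip (N v : R) : R := Num.min (Num.max v 0) N.

Lemma clip_continuous N : continuous (clip N).
Proof.
apply: min_fun_continuous; last by move=> x; exact: cvg_cst.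
by apply: max_fun_continuous => x; [exact: cvg_id|exact: cvg_cst].
Qed.

Lemma clip_ge0 N v : 0 <= N -> 0 <= clip N v.
Proof. by move=> N0; rewrite /clip le_min le_max lexx orbT. Qed.

Lemma clip_le N v : clip N v <= N.
Proof. by rewrite /clip ge_min lexx orbT. Qed.

Lemma clip_le_max N v : clip N v <= Num.max v 0.
Proof. by rewrite /clip ge_min lexx. Qed.

Lemma clip_norm N v : 0 <= N -> `|clip N v| <= N.
Proof. by move=> N0; rewrite ger0_norm ?clip_ge0// clip_le. Qed.

Lemma clip_homo N N' v : N <= N' -> clip N v <= clip N' v.
Proof. by move=> NN; rewrite /clip le_min !ge_min lexx NN orbT. Qed.

Lemma clip_opp N v : Num.max (Num.min v 0) (- N) = - clip N (- v).
Proof. by rewrite /clip oppr_min oppr_max opprK oppr0. Qed.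

Lemma measurable_clip N g : measurable_fun setT g ->
  measurable_fun setT (fun x => clip N (g x)).
Proof.
move=> mg; apply: (measurableT_comp (f := clip N) _ mg).
apply: continuous_measurable_fun; exact: clip_continuous.
Qed.

Definition trunc_integral g (p : R * R) : \bar R :=
  \int[leb n]_(x in disc p.1%:E) (clip p.2 (g x))%:E.

Lemma trunc_integral_homo g (p q : R * R) : measurable_fun setT g ->
  0 <= p.2 -> p.1 <= q.1 -> p.2 <= q.2 ->
  (trunc_integral g p <= trunc_integral g q)%E.
Proof.
move=> mg p0 pq1 pq2; rewrite /trunc_integral.
have mc N D : measurable_fun D (fun x => (clip N (g x))%:E).
  by apply: measurable_funTS; apply/measurable_EFinP; exact: measurable_clip.
apply: (@le_trans _ _ (\int[leb n]_(x in disc p.1%:E) (clip q.2 (g x))%:E)%E).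
  apply: ge0_le_integral => //; first exact: measurable_disc.
  - by move=> x _; rewrite lee_fin clip_ge0.
  - by move=> x _; rewrite lee_fin clip_homo.
apply: ge0_subset_integral => //.
- exact: measurable_disc.
- exact: measurable_disc.
- by move=> x _; rewrite lee_fin clip_ge0// (le_trans p0).
- by move=> x; rewrite !discE/= => /le_trans; apply.
Qed.

Lemma trunc_integral_le g (p : R * R) : measurable_fun setT g -> 0 <= p.2 ->
  (trunc_integral g p <= \int[leb n]_x (Num.max (g x) 0)%:E)%E.
Proof.
move=> mg p0; rewrite /trunc_integral.
have mm : measurable_fun setT (fun x => (Num.max (g x) 0)%:E).
  by apply/measurable_EFinP; exact: measurable_maxr.
apply: (@le_trans _ _ (\int[leb n]_(x in disc p.1%:E) (Num.max (g x) 0)%:E)%E).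
  apply: ge0_le_integral => //; first exact: measurable_disc.
  - by move=> x _; rewrite lee_fin clip_ge0.
  - by apply: measurable_funTS; apply/measurable_EFinP; exact: measurable_clip.
  - exact: measurable_funTS.
  - by move=> x _; rewrite lee_fin clip_le_max.
apply: ge0_subset_integral => //; first exact: measurable_disc.
by move=> x _; rewrite lee_fin le_max lexx orbT.
Qed.

Lemma trunc_integral_diag_cvg g : measurable_fun setT g ->
  (trunc_integral g (k%:R, k%:R) @[k --> \oo] -->
   \int[leb n]_x (Num.max (g x) 0)%:E)%E.
Proof.
move=> mg; pose u (k : nat) x := (cutoff k%:R (fun x => clip k%:R (g x)) x)%:E.
have := @cvg_monotone_convergence _ _ _ (leb n) setT measurableT u.
have mu k : measurable_fun setT (u k).
  apply/measurable_EFinP; apply: measurable_cutoff; exact: measurable_clip.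
have u0 k x : setT x -> (0 <= u k x)%E.
  by move=> _; rewrite lee_fin mulr_ge0// clip_ge0.
have u_homo x : setT x -> {homo u^~ x : k l / (k <= l)%N >-> (k <= l)%E}.
  move=> _ k l kl; rewrite lee_fin /cutoff ler_pM ?clip_ge0//.
    by rewrite clip_homo// ler_nat.
  rewrite !indicE; have [xk|//] := boolP (x \in disc k%:R%:E).
  rewrite mem_set//; move: xk; rewrite inE !discE/= => /le_trans; apply.
  by rewrite ler_nat.
move=> /(_ mu u0 u_homo).
rewrite (_ : (fun k => \int[leb n]_x u k x)%E =
    (fun k => trunc_integral g (k%:R, k%:R))); last first.
  by apply/funext => k; rewrite integral_cutoff.
rewrite (eq_integral (fun x => (Num.max (g x) 0)%:E))// => x _.
apply: cvg_lim => //; apply: cvg_near_cst.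
have : \forall k \near \oo, Num.max (enorm x) (Num.max (g x) 0) <= k%:R.
  exact: nbhs_infty_ger.
apply: filterS => k; rewrite ge_max => /andP[xk gk].
rewrite /u /cutoff indicE mem_set ?discE// mulr1 /clip.
by rewrite min_l.
Qed.

(** The truncated integrals increase in both parameters, so they are squeezed
    between the diagonal sequence and its limit. *)
Lemma trunc_integral_cvg g : measurable_fun setT g ->
  (trunc_integral g p @[p --> filter_prod (pinfty_nbhs R) (pinfty_nbhs R)] -->
   \int[leb n]_x (Num.max (g x) 0)%:E)%E.
Proof.
move=> mg.
pose k (p : R * R) := Num.truncn (Num.min p.1 p.2).
have pos : \forall p \near filter_prod (pinfty_nbhs R) (pinfty_nbhs R),
    0 <= p.1 /\ 0 <= p.2.
  exists ([set x | 0 <= x], [set x | 0 <= x]) => //=.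
  by split; exact: nbhs_pinfty_ge.
have kcvg : k p @[p --> filter_prod (pinfty_nbhs R) (pinfty_nbhs R)] --> \oo.
  move=> A [K _ KA].
  exists ([set x | K%:R <= x], [set x | K%:R <= x]) => /=.
    by split; exact: nbhs_pinfty_ge.
  move=> [x y] /= [Kx Ky]; apply: KA => /=.
  have Kxy : K%:R <= Num.min x y by rewrite le_min Kx.
  by rewrite /k truncn_ge_nat// (le_trans _ Kxy).
apply: (@squeeze_cvge _ _ _ _
  (fun p => trunc_integral g ((k p)%:R, (k p)%:R)) _
  (cst (\int[leb n]_x (Num.max (g x) 0)%:E)%E)).
- apply: filterS pos => p [p1 p2]; apply/andP; split; last exact: trunc_integral_le.
  have kp : (k p)%:R <= Num.min p.1 p.2 by rewrite /k truncn_le// le_min p1.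
  by move: kp; rewrite le_min => /andP[kp1 kp2]; apply: trunc_integral_homo.
- exact: (cvg_comp _ _ kcvg (trunc_integral_diag_cvg mg)).
- exact: cvg_cst.
Qed.

End Truncation.

Section TonelliLebesgue.
Context {R : realType} {n : nat} (n_gt0 : (0 < n)%N).
Variables (f : 'rV[R]_n -> option R) (g : 'rV[R]_n -> R).
Hypotheses (fq : quasicontinuous +oo f) (fg : version f g).

Let mg : measurable_fun setT g. Proof. by have [] := fg. Qed.
Let mNg : measurable_fun setT (fun x => - g x). Proof. exact: measurable_funN. Qed.

Let trunc_integral_fin_num h (p : R * R) : measurable_fun setT h -> 0 <= p.2 ->
  trunc_integral (n := n) h p \is a fin_num.
Proof.
move=> mh p2; apply: integrable_fin_num; first exact: measurable_disc.
apply: (@integrable_disc _ _ p.1 p.2) => [|x]; first exact: measurable_clip.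
exact: clip_norm.
Qed.

Let posP : \forall p \near filter_prod (pinfty_nbhs R) (pinfty_nbhs R),
  0 < p.1 /\ 0 <= p.2.
Proof.
exists ([set x | 0 < x], [set x | 0 <= x]) => //=.
by split; [exact: nbhs_pinfty_gt|exact: nbhs_pinfty_ge].
Qed.

Let omap_norm (phi : R -> R) (N : R) : (forall v, `|phi v| <= N) ->
  forall x, `|pval (fun x => omap phi (f x)) x| <= N.
Proof.
move=> phiN x; rewrite /pval; case: (f x) => [v|] //=.
by rewrite normr0 (le_trans (normr_ge0 _) (phiN 0)).
Qed.

Lemma bounded_integral_trunc_pos (p : R * R) : 0 < p.1 -> 0 <= p.2 ->
  (bounded_integral p.1 (trunc_pos p.2 f))%:E = trunc_integral g p.
Proof.
move=> p1 p2; have cN : continuous (clip p.2) by exact: clip_continuous.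
rewrite /trunc_pos (bounded_integralE n_gt0 (M := p.2) p1
  (quasicontinuous_omap cN fq) (version_omap cN fg)).
- by rewrite fineK// trunc_integral_fin_num.
- by apply: omap_norm => v; exact: clip_norm.
- by move=> x; exact: clip_norm.
Qed.

Lemma bounded_integral_trunc_neg (p : R * R) : 0 < p.1 -> 0 <= p.2 ->
  (bounded_integral p.1 (trunc_neg p.2 f))%:E =
  (- trunc_integral (fun x => - g x)%R p)%E.
Proof.
move=> p1 p2; pose phi (v : R) := - clip p.2 (- v).
have cphi : continuous phi.
  move=> v; apply: (@continuous_comp _ _ _
    (fun v : R => clip p.2 (- v)) (fun v : R => - v)); last exact: opp_continuous.
  apply: (@continuous_comp _ _ _ (fun v : R => - v) (clip p.2)).
    exact: opp_continuous.
  exact: clip_continuous.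
have -> : trunc_neg p.2 f = (fun x => omap phi (f x)).
  by apply/funext => x; rewrite /trunc_neg; case: (f x) => //= v; rewrite clip_opp.
have phiN v : `|phi v| <= p.2 by rewrite normrN clip_norm.
rewrite (bounded_integralE n_gt0 (M := p.2) p1
  (quasicontinuous_omap cphi fq) (version_omap cphi fg)) //; last exact: omap_norm.
have fin := trunc_integral_fin_num mNg p2.
rewrite (eq_integral (fun x => - (clip p.2 (- g x))%:E)%E)// integralN.
  by rewrite fineK// fin_numN.
have : (leb n).-integrable (disc p.1%:E) (EFin \o (fun x => clip p.2 (- g x))).
  apply: (@integrable_disc _ _ p.1 p.2) => [|x]; first exact: measurable_clip.
  exact: clip_norm.
move=> ii; apply: (integrable_add_def _ ii); exact: measurable_disc.
Qed.

Lemma integral_posE : integral_pos f = (\int[leb n]_x (Num.max (g x) 0)%:E)%E.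
Proof.
apply: cvg_lim => //; apply: cvg_trans (trunc_integral_cvg mg).
apply: near_eq_cvg; apply: filterS posP => p [p1 p2].
by rewrite bounded_integral_trunc_pos.
Qed.

(** The truncation max{f_-, -K} is the opposite of min{(-f)_+, K}. *)
Lemma integral_negE :
  integral_neg f = (- \int[leb n]_x (Num.max (- g x) 0)%:E)%E.
Proof.
apply: cvg_lim => //; apply: cvg_trans (cvgeN (trunc_integral_cvg mNg)).
apply: near_eq_cvg; apply: filterS posP => p [p1 p2].
by rewrite bounded_integral_trunc_neg.
Qed.

Lemma tonelli_integralE : tonelli_integral f = (\int[leb n]_x (g x)%:E)%E.
Proof.
rewrite /tonelli_integral integral_posE integral_negE [RHS]integralE.
congr (_ + - _)%E.
  by apply: eq_integral => x _; rewrite funeposE EFin_max.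
by apply: eq_integral => x _; rewrite funenegE EFin_max.
Qed.

(** Summability asks for a finite sum of \int f_+ >= 0 and \int f_- <= 0; as
    +oo - oo is -oo in the extended reals, this forces both to be finite. *)
Lemma tonelli_summableE :
  tonelli_summable f <-> (leb n).-integrable setT (fun x => (g x)%:E).
Proof.
rewrite /tonelli_summable /tonelli_integrable /tonelli_integral.
rewrite integral_posE integral_negE.
have mp : measurable_fun setT (fun x => (Num.max (g x) 0)%:E).
  by apply/measurable_EFinP; exact: measurable_maxr.
have mn : measurable_fun setT (fun x => (Num.max (- g x) 0)%:E).
  by apply/measurable_EFinP; exact: measurable_maxr.
have p0 (h : 'rV[R]_n -> R) x : (0 <= (Num.max (h x) 0)%:E)%E.
  by rewrite lee_fin le_max lexx orbT.
have absE : (\int[leb n]_x `|(g x)%:E| = \int[leb n]_x (Num.max (g x) 0)%:E +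
    \int[leb n]_x (Num.max (- g x) 0)%:E)%E.
  rewrite -(ge0_integralD (leb n) measurableT (fun x _ => p0 g x) mp
    (fun x _ => p0 (fun x => - g x) x) mn).
  apply: eq_integral => x _; rewrite -EFinD; congr EFin.
  rewrite /=; have [g0|g0] := leP 0 (g x).
    by rewrite ger0_norm// max_r ?addr0// oppr_le0.
  by rewrite ltr0_norm// max_l ?add0r// oppr_ge0 ltW.
have posge0 : (0 <= \int[leb n]_x (Num.max (g x) 0)%:E)%E.
  by apply: integral_ge0 => x _; exact: p0.
have negge0 : (0 <= \int[leb n]_x (Num.max (- g x) 0)%:E)%E.
  by apply: integral_ge0 => x _; exact: (p0 (fun x => - g x)).
split=> [[_]|ig].
  move=> fin; apply/integrableP; split; first exact/measurable_EFinP.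
  rewrite absE; move: posge0 negge0 fin.
  case: (\int[_]_x _)%E => [a||] //; case: (\int[_]_x _)%E => [b||] // _ _ _.
  by rewrite ltry.
have /integrableP[_] := ig; rewrite absE; move: posge0 negge0.
case: (\int[_]_x _)%E => [a||] //; case: (\int[_]_x _)%E => [b||] // _ _ _.
by split => //; split => //; left.
Qed.

End TonelliLebesgue.

(** * Slices *)

Lemma continuous_within_comp (S T U : topologicalType) (h : S -> T) (F : T -> U)
    (D : set T) (D' : set S) : continuous h -> (forall x, D' x -> D (h x)) ->
  {within D, continuous F} -> {within D', continuous (F \o h)}.
Proof.
move=> /continuousP ch hD /continuousP cF; apply/continuousP => A oA.
have [V oV VE] := (open_subspaceP D _).1 (cF _ oA).
apply/open_subspaceP; exists (h @^-1` V); first exact: ch.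
apply/seteqP; split=> x /= [Hx D'x]; split => //.
  have : (V `&` D) (h x) by split => //; exact: hD.
  by rewrite VE => -[].
have : ((from_subspace D F @^-1` A) `&` D) (h x) by split => //; exact: hD.
by rewrite -VE => -[].
Qed.

Section Slices.
Context {R : realType}.

(** The set where f is undefined is covered by each I_Delta. *)
Lemma quasicontinuous_off n (f : 'rV[R]_n -> option R) :
  (forall e : R, 0 < e -> exists Delta, continuous_off +oo f e Delta) ->
  quasicontinuous +oo f.
Proof.
move=> fq; split => //; exists [set x | ~ defined_at f x]; split; last first.
  by move=> x _ /= /contrapT.
move=> e e0; have [Delta [Le _ df _]] := fq e e0; exists Delta; split => //.
move=> x /= ndx; apply: contrapT => xD; apply: ndx; apply: df; split => //.
by rewrite disc_pinfty.
Qed.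

Variable n : nat.
Hypothesis n_gt0 : (0 < n)%N.
Implicit Types (r : rectangle (R := R) (n := 1 + n)).

(** For x outside the first side of r, sides `]0, 0[ give an empty rectangle of
    length 0, because n > 0. *)
Definition rect_section r (x : R) : rectangle (R := R) (n := n) :=
  fun i => if x \in r (lshift n ord0) then r (rshift 1 i) else `]0, 0[.

Lemma rect_set_section r x y :
  rect_set (rect_section r x) y <-> rect_set r (consV (x, y)).
Proof.
split=> [H i|H i].
  pose i0 := Ordinal n_gt0.
  have xr : x \in r (lshift n ord0).
    have := H i0; rewrite /rect_section; case: ifP => // _.
    by rewrite in_itv/= => /andP[/lt_trans h /h]; rewrite ltxx.
  case: (split_ordP i) => j ->; first by rewrite [j]ord1 consV0.
  by have := H j; rewrite /rect_section xr consVS.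
have := H (lshift n ord0); rewrite consV0 /rect_section /= => ->.
by have := H (rshift 1 i); rewrite consVS.
Qed.

Lemma rect_L_section r x : rect_L (rect_section r x) =
  (rect_L (fun i => r (rshift 1 i)) * (\1_[set` r (lshift n ord0)] x)%:E)%E.
Proof.
rewrite indicE /rect_section /rect_L.
have -> : (x \in [set` r (lshift n ord0)]) = (x \in r (lshift n ord0)).
  by apply/idP/idP => [/set_mem//|xr]; exact/mem_set.
have [xr|_] := boolP (x \in r (lshift n ord0)); first by rewrite mule1.
by rewrite mule0 (bigD1 (Ordinal n_gt0))//= /itv_length /= ltxx mul0e.
Qed.

Lemma rect_L_ge0 m (r : rectangle (R := R) (n := m)) : (0 <= rect_L r)%E.
Proof. by rewrite -leb_rect_set measure_ge0. Qed.

Lemma integral_rect_L_section r :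
  (\int[lebesgue_measure]_x rect_L (rect_section r x) = rect_L r)%E.
Proof.
under eq_integral do rewrite rect_L_section.
have mi : measurable_fun setT
    (fun x : measurableTypeR R => (\1_[set` r (lshift n ord0)] x)%:E : \bar R).
  by apply/measurable_EFinP; apply: measurable_indic; exact: measurable_itv.
have mr : measurable ([set` r (lshift n ord0)] : set (measurableTypeR R)).
  exact: measurable_itv.
rewrite (ge0_integralZl _ measurableT mi _ (rect_L_ge0 _))//.
rewrite (integral_indic _ measurableT mr) setIT muleC /rect_L.
rewrite [RHS]big_ord_recl; congr (_ * _)%E.
  rewrite (_ : ord0 = @lshift 1 n ord0); last exact: val_inj.
  exact: lebesgue_measure_itv.
apply: eq_bigr => i _; congr (itv_length (r _)); exact: val_inj.
Qed.

Definition mrect_section (Delta : multirectangle (R := R) (n := 1 + n)) x :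
  multirectangle (R := R) (n := n) := fun k => rect_section (Delta k) x.

Lemma measurable_mrect_L_section Delta :
  measurable_fun setT
    (fun x : measurableTypeR R => mrect_L (mrect_section Delta x)).
Proof.
apply: ge0_emeasurable_sum => [k x _ _|k _]; first exact: rect_L_ge0.
rewrite /mrect_section; under eq_fun do rewrite rect_L_section.
apply: emeasurable_funM => //.
by apply/measurable_EFinP; apply: measurable_indic; exact: measurable_itv.
Qed.

Lemma integral_mrect_L_section Delta :
  (\int[lebesgue_measure]_x mrect_L (mrect_section Delta x) = mrect_L Delta)%E.
Proof.
rewrite /mrect_L /mrect_section integral_nneseries//.
- by apply: eq_eseriesr => k _; exact: integral_rect_L_section.
- move=> k; under eq_fun do rewrite rect_L_section.
  apply: emeasurable_funM => //.
  by apply/measurable_EFinP; apply: measurable_indic; exact: measurable_itv.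
- by move=> k x _; exact: rect_L_ge0.
Qed.

(** Markov's inequality: for each m, the set of x whose sections all have
    length at least 1 / (m + 1) has measure at most (m + 1) / (j + 1) for all j. *)
Lemma ae_mrect_L_section (Delta : nat -> multirectangle (R := R) (n := 1 + n)) :
  (forall j, (mrect_L (Delta j) < j.+1%:R^-1%:E)%E) ->
  {ae (@lebesgue_measure R), forall x, forall e : R, 0 < e ->
    exists j, (mrect_L (mrect_section (Delta j) x) < e%:E)%E}.
Proof.
move=> DL.
pose phi j x := mrect_L (mrect_section (Delta j) x).
have phi0 j x : (0 <= phi j x)%E.
  by apply: nneseries_ge0 => k _ _; exact: rect_L_ge0.
have H m : {ae (@lebesgue_measure R), forall x,
    exists j, (phi j x < m.+1%:R^-1%:E)%E}.
  pose B j := [set x : measurableTypeR R | (m.+1%:R^-1%:E <= phi j x)%E].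
  have mB j : measurable (B j).
    rewrite -[B j]setTI; apply: emeasurable_fun_c_infty => //.
    exact: measurable_mrect_L_section.
  exists (\bigcap_j B j); split; first exact: bigcapT_measurable.
  - apply/eqP; rewrite -measure_le0; apply/lee_addgt0Pr => e e0; rewrite add0e.
    have em0 : 0 < e * m.+1%:R^-1 by rewrite mulr_gt0.
    have [j _ /(_ j (leqnn _)) /= je] := near_infty_natSinv_lt (PosNum em0).
    apply: (@le_trans _ _ (lebesgue_measure (B j))).
      have mBI : measurable (\bigcap_j B j) by exact: bigcapT_measurable.
      by apply: le_measure; [exact: mem_set|exact: mem_set|exact: bigcap_inf].
    rewrite -(@lee_pmul2l _ m.+1%:R^-1%:E)// -?EFinM ?lte_fin//.
    apply: (@le_trans _ _ (mrect_L (Delta j))); last first.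
      apply: (le_trans (ltW (DL j))); rewrite lee_fin; apply/ltW.
      by rewrite [_ * e]mulrC.
    rewrite -integral_mrect_L_section -[X in lebesgue_measure X]setIT.
    have mI : measurable_fun setT (fun x => (\1_(B j) x)%:E : \bar R).
      by apply/measurable_EFinP; exact: measurable_indic.
    rewrite -integral_indic// -(ge0_integralZl _ measurableT mI)//.
    apply: (ge0_le_integral _ measurableT) => [x _|||x _].
    + by rewrite -EFinM lee_fin mulr_ge0.
    + exact: emeasurable_funM.
    + exact: measurable_mrect_L_section.
    + rewrite indicE; have [xB|_] := boolP (x \in B j).
        by rewrite mule1; move: xB; rewrite inE.
      by rewrite mule0; exact: phi0.
  - move=> x /= nx k _; rewrite /B/= leNgt; apply/negP => xk; apply: nx.
    by exists k.
have /ae_foralln := H; apply: filterS => x Hx e e0.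
have [m _ /(_ m (leqnn _)) /= me] := near_infty_natSinv_lt (PosNum e0).
have [j xj] := Hx m; exists j; apply: lt_trans xj _.
by rewrite lte_fin.
Qed.

Lemma consV_continuous x : continuous (fun y : 'rV[R]_n => consV (x, y)).
Proof.
move=> y A /nbhs_ballP[e /= e0 eA]; apply/nbhs_ballP; exists e => //= z [_ yz].
apply: eA; split=> // i j; rewrite (ord1 i).
case: (split_ordP j) => k ->; first by rewrite [k]ord1 !consV0; exact: ballxx.
by rewrite !consVS; exact: yz.
Qed.

(** The sections at x of the multirectangles adapted to f are adapted to
    f(x, .), and for almost every x their lengths come arbitrarily close to 0. *)
Lemma quasicontinuous_slice (f : 'rV[R]_(1 + n) -> option R) :
  quasicontinuous +oo f ->
  {ae (@lebesgue_measure R), forall x,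
    quasicontinuous +oo (fun y => f (consV (x, y)))}.
Proof.
move=> [_ fq].
have j0 j : 0 < j.+1%:R^-1 :> R by rewrite invr_gt0.
have [Delta DP] := choice (fun j => fq _ (j0 j)).
have DL j : (mrect_L (Delta j) < j.+1%:R^-1%:E)%E by have [] := DP j.
have [A [mA A0 sA]] := ae_mrect_L_section DL.
exists A; split => // x /= nx; apply: sA => /= Hx; apply: nx.
apply: quasicontinuous_off => e e0; have [j xj] := Hx e e0.
have [_ oU df _] := DP j; have cf := continuous_off_setT (DP j).
exists (mrect_section (Delta j) x).
have sE : mrect_set (mrect_section (Delta j) x) =
    (fun y => consV (x, y)) @^-1` mrect_set (Delta j).
  by apply/seteqP; split=> y [k _ /rect_set_section yk]; exists k.
split => //.
- by rewrite sE; apply: open_comp oU => y _; exact: consV_continuous.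
- move=> y [_ yU]; apply: df; split; first by rewrite disc_pinfty.
  by move=> U; apply: yU; rewrite sE.
- rewrite disc_pinfty setTD sE.
  exact: continuous_within_comp (@consV_continuous x) _ cf.
Qed.

End Slices.

(** * The one-dimensional case *)

Section OneDimensional.
Context {R : realType}.
Implicit Types (A B N : set (measurableTypeR R)) (Phi : R -> R).

(** On the line, Lebesgue outer measure is an infimum over covers by bounded
    open intervals, and such a cover is a multirectangle with open union. *)
Lemma open_cover1 B (e : R) : (lebesgue_measure B < e%:E)%E ->
  exists Delta : multirectangle (R := R) (n := 1),
    [/\ (mrect_L Delta < e%:E)%E, open (mrect_set Delta) &
     forall x : 'rV[R]_1, B (x ord0 ord0) -> mrect_set Delta x].
Proof.
move=> Be.
have : (((@wlength R idfun)^* B)%mu < e%:E)%E by exact: Be.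
rewrite outer_measure_open_itv_cover => /ereal_inf_lt[_ [F [Fo BF] <-] Fe].
have [ab abP] := choice Fo.
pose Delta : multirectangle (R := R) (n := 1) :=
  fun k => fun=> `](ab k).1, (ab k).2[.
have setE : mrect_set Delta =
    (fun x : 'rV[R]_1 => x ord0 ord0) @^-1` (\bigcup_k F k).
  apply/seteqP; split=> x [k _].
    by move=> /(_ ord0) xk; exists k => //; rewrite abP.
  by rewrite abP => xk; exists k => // i; rewrite [i]ord1.
exists Delta; split.
- apply: le_lt_trans Fe; apply: lee_nneseries => k _.
    by rewrite -leb_rect_set measure_ge0.
  by rewrite abP wlength_itv /rect_L big_ord1 /itv_length /= lte_fin.
- rewrite setE; apply: open_comp; first by move=> x _; exact: coord_continuous.
  by apply: bigcup_open => k _; rewrite abP; exact: interval_open.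
- by move=> x /BF; rewrite setE.
Qed.

Lemma null_set1 N : lebesgue_measure N = 0%E ->
  Defs.null_set [set x : 'rV[R]_1 | N (x ord0 ord0)].
Proof.
move=> N0 e e0; have [|Delta [Le _ ND]] := @open_cover1 N e.
  by rewrite N0 lte_fin.
by exists Delta; split.
Qed.

(** Lusin's theorem on the bounded interval [-k, k] gives a compact set that
    misses a part of measure at most e / 2^(k + 2). Removing all these parts
    leaves a set on which Phi is continuous, since continuity at x only involves
    one interval with k > |x|. *)
Lemma lusin Phi (e : R) : measurable_fun setT Phi -> 0 < e ->
  exists B, [/\ measurable B, (lebesgue_measure B < e%:E)%E &
    {within ~` (B : set R), continuous Phi}].
Proof.
move=> mPhi e0.
pose A (k : nat) : set (measurableTypeR R) := `[- k%:R, k%:R]%classic.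
have mA k : measurable (A k) by exact: measurable_itv.
have Aoo k : (lebesgue_measure (A k) < +oo)%E.
  rewrite [X in (X < _)%E](lebesgue_measure_itv `[- k%:R, k%:R])/=.
  by case: ifP => _; rewrite ltry.
pose d (k : nat) : R := e / 2 / (2 ^ k.+1)%:R.
have d0 k : 0 < d k by rewrite !divr_gt0// ltr0n expn_gt0.
have KE k : exists K : set R, [/\ compact K, K `<=` A k,
    (lebesgue_measure (A k `\` K) < (d k)%:E)%E & {within K, continuous Phi}].
  apply: (measurable_almost_continuous (mA k) (Aoo k) (d0 k)).
  exact: (measurable_funS measurableT _ mPhi).
have [K KP] := choice KE.
have mK k : measurable (A k `\` K k : set (measurableTypeR R)).
  by apply: measurableD => //; have [cK _ _ _] := KP k; exact: compact_measurable.
have mB : measurable (\bigcup_k (A k `\` K k)) by exact: bigcup_measurable.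
exists (\bigcup_k (A k `\` K k)); split => //.
- apply: (@le_lt_trans _ _ (\sum_(0 <= k <oo) (d k)%:E)%E).
    apply: le_trans (measure_sigma_subadditive _ mK mB _) _ => //.
    by apply: lee_nneseries => // k _; have [_ _ /ltW] := KP k.
  apply: (@le_lt_trans _ _ (e / 2)%:E); last by rewrite lte_fin; lra.
  by apply: epsilon_trick0; rewrite divr_ge0// ltW.
- apply/subspace_continuousP => x nBx V PhiV.
  (* Points near x that lie outside all removed parts belong to K k. *)
  pose k := (Num.truncn `|x|).+1.
  have xk : `|x| < k%:R by exact: truncnS_gt.
  have kE (y : R) : `|y| < k%:R -> ~ (\bigcup_k (A k `\` K k)) y -> K k y.
    move=> yk nBy; apply: contrapT => nKy; apply: nBy; exists k => //; split => //.
    by rewrite /A/= in_itv/=; move: yk; rewrite ltr_norml => /andP[/ltW-> /ltW->].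
  have [_ _ _ /subspace_continuousP cK] := KP k.
  have near1 : \forall y \near (x : R^o), `|y| < k%:R.
    by have := @norm_continuous _ R^o x _ (lt_nbhsl xk).
  have near2 : \forall y \near x, K k y -> V (Phi y).
    exact: cK x (kE _ xk nBx) V PhiV.
  apply: filterS2 near1 near2 => y yk Vy nBy; apply: Vy; exact: kE.
Qed.

(** The exceptional sets of Lusin's theorem and of the a.e. equality are
    covered together by a small open multirectangle. *)
Lemma quasicontinuous1 (p : 'rV[R]_1 -> option R) Phi N :
  measurable_fun setT Phi -> measurable N -> lebesgue_measure N = 0%E ->
  (forall x : 'rV[R]_1, ~ N (x ord0 ord0) -> p x = Some (Phi (x ord0 ord0))) ->
  quasicontinuous +oo p.
Proof.
move=> mPhi mN N0 pE; apply: quasicontinuous_off => e e0.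
have [B [mB Be cB]] := lusin mPhi e0.
have BN : (lebesgue_measure (B `|` N) < e%:E)%E.
  by apply: le_lt_trans (measureU2 _ mB mN) _; rewrite [X in (_ + X)%E]N0 adde0.
have [Delta [Le oD BD]] := open_cover1 BN.
have nD x : (disc +oo `\` mrect_set Delta) x ->
    ~ B (x ord0 ord0) /\ ~ N (x ord0 ord0).
  by move=> [_ xD]; apply/not_orP => BNx; apply: xD; exact: BD.
exists Delta; split => //.
- by move=> x /nD[_ nNx]; rewrite /defined_at pE.
- apply: (@subspace_eq_continuous _ _ _ (Phi \o (fun x : 'rV[R]_1 => x ord0 ord0))).
    have E x : (disc +oo `\` mrect_set Delta) x ->
      (Phi \o (fun x : 'rV[R]_1 => x ord0 ord0)) x = pval p x.
      by move=> /nD[_ nNx]; rewrite /pval pE.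
    by move=> x; rewrite inE; exact: E.
  apply: (continuous_within_comp _ _ cB); first exact: coord_continuous.
  by move=> x /nD[].
Qed.

Lemma ge0_integral_leb1 (h : R -> \bar R) : measurable_fun setT h ->
  (forall x, 0 <= h x)%E ->
  (\int[leb 1]_x h (x ord0 ord0) = \int[lebesgue_measure]_x h x)%E.
Proof.
move=> mh h0.
have cE (x : R) (y : 'rV[R]_0) : consV (x, y) ord0 ord0 = x.
  rewrite -[RHS](consV0 (x, y)); congr (fun_of_matrix (consV _) _ _).
  exact/val_inj.
transitivity (\int[lebesgue_measure]_x \int[leb 0]_y h (consV (x, y) ord0 ord0))%E.
  apply: (@ge0_integral_leb R 0 (fun x => h (x ord0 ord0))) => //.
  by apply: (measurableT_comp mh); exact: measurable_coord.
apply: eq_integral => x _.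
transitivity (\int[leb 0]_y (cst (h x) y))%E.
  by apply: eq_integral => y _; rewrite cE.
rewrite integral_cst//.
transitivity (h x * @dirac _ 'rV[R]_0 0%R R setT)%E => //.
by rewrite diracT mule1.
Qed.

Lemma integral_leb1 (h : R -> R) : measurable_fun setT h ->
  (\int[leb 1]_x (h (x ord0 ord0))%:E = \int[lebesgue_measure]_x (h x)%:E)%E.
Proof.
move=> mh; rewrite [LHS]integralE [RHS]integralE.
have mhE : measurable_fun setT (fun x => (h x)%:E) by exact/measurable_EFinP.
congr (_ - _)%E.
  rewrite -(ge0_integral_leb1 (measurable_funepos mhE)) => [|x].
    by apply: eq_integral => x _; rewrite !funeposE.
  exact: funepos_ge0.
rewrite -(ge0_integral_leb1 (measurable_funeneg mhE)) => [|x].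
  by apply: eq_integral => x _; rewrite !funenegE.
exact: funeneg_ge0.
Qed.

Lemma integrable_leb1 (h : R -> R) : measurable_fun setT h ->
  lebesgue_measure.-integrable setT (fun x => (h x)%:E) ->
  (leb 1).-integrable setT (fun x => (h (x ord0 ord0))%:E).
Proof.
move=> mh ih.
have mhE : measurable_fun setT (fun x => (h x)%:E) by exact/measurable_EFinP.
have mhA : measurable_fun setT (fun x => `|(h x)%:E|%E) by exact: measurableT_comp.
apply/integrableP; split.
  by apply: (measurableT_comp mhE); exact: measurable_coord.
by rewrite (ge0_integral_leb1 mhA)//; have /integrableP[] := ih.
Qed.

Lemma version1 (p : 'rV[R]_1 -> option R) Phi N :
  measurable_fun setT Phi -> measurable N -> lebesgue_measure N = 0%E ->
  (forall x : 'rV[R]_1, ~ N (x ord0 ord0) -> p x = Some (Phi (x ord0 ord0))) ->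
  version p (fun x => Phi (x ord0 ord0)).
Proof.
move=> mPhi mN N0 pE; split.
  by apply: (measurableT_comp mPhi); exact: measurable_coord.
exists ((fun x : 'rV[R]_1 => x ord0 ord0) @^-1` N).
have mN1 : measurable ((fun x : 'rV[R]_1 => x ord0 ord0) @^-1` N).
  by rewrite -[X in measurable X]setTI; exact: measurable_coord.
split => //.
have mI : measurable_fun setT (fun x => (\1_N x)%:E : \bar R).
  by apply/measurable_EFinP; exact: measurable_indic.
rewrite -[X in leb _ X]setIT -integral_indic//.
transitivity (\int[leb 1]_x (\1_N (x ord0 ord0))%:E)%E.
  by apply: eq_integral => x _; rewrite !indicE.
rewrite (ge0_integral_leb1 mI); last by move=> x; rewrite lee_fin.
by rewrite integral_indic// setIT.
Qed.

End OneDimensional.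

(** * The reduction formula *)

Section Reduction.
Context {R : realType} {d : nat} (d_gt0 : (0 < d)%N).
Implicit Types (F : 'rV[R]_(1 + d) -> option R) (g : 'rV[R]_(1 + d) -> R).

Lemma measurable_consV_pt (x : R) :
  measurable_fun setT (fun y : 'rV[R]_d => consV (x, y)).
Proof.
apply: measurable_fun_rV => U oU; apply: open_measurable_rV.
by apply: open_comp oU => y _; exact: consV_continuous.
Qed.

Lemma measurable_slice g x : measurable_fun setT g ->
  measurable_fun setT (fun y : 'rV[R]_d => g (consV (x, y))).
Proof. by move=> mg; apply: (measurableT_comp mg); exact: measurable_consV_pt. Qed.

(** Almost every section of a null set is null. *)
Lemma version_slice F g : version F g ->
  {ae (@lebesgue_measure R), forall x,
    version (fun y => F (consV (x, y))) (fun y => g (consV (x, y)))}.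
Proof.
move=> [mg [N [mN N0 FN]]].
have mI : measurable_fun setT (fun z => (\1_N z)%:E : \bar R).
  by apply/measurable_EFinP; exact: measurable_indic.
have mS x : measurable [set y : 'rV[R]_d | N (consV (x, y))].
  rewrite -[X in measurable X]setTI.
  exact: measurable_consV_pt.
pose s x := leb d [set y | N (consV (x, y))].
have sE x : (\int[leb d]_y (\1_N (consV (x, y)))%:E = s x)%E.
  transitivity (\int[leb d]_y (\1_[set y | N (consV (x, y))] y)%:E)%E.
    by apply: eq_integral => y _; rewrite !indicE.
  by rewrite integral_indic// setIT.
have ms : measurable_fun setT (s : measurableTypeR R -> \bar R).
  rewrite (_ : s = (fun x => \int[leb d]_y (\1_N (consV (x, y)))%:E)%E); last first.
    by apply/funext => x; rewrite sE.
  apply: (@measurable_fun_fubini_tonelli_F _ _ _ _ R (leb d)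
    (fun p => (\1_N (consV p))%:E)).
    by apply: (measurableT_comp mI); exact: measurable_consV.
  by move=> p; rewrite lee_fin.
have s0 : (\int[lebesgue_measure]_x s x = 0)%E.
  rewrite -(eq_integral _ _ (fun x _ => sE x)).
  rewrite -(@ge0_integral_leb R d (fun z => (\1_N z)%:E))//.
  by rewrite integral_indic// setIT.
have s_ge0 x : (0 <= s x)%E by exact: measure_ge0.
have : ae_eq lebesgue_measure setT (s : measurableTypeR R -> \bar R) (cst 0).
  apply/ae_eq_integral_abs => //.
  by rewrite -[RHS]s0; apply: eq_integral => x _; rewrite gee0_abs.
case=> A [mA A0 sA]; exists A; split => // x /= nx; apply: sA => /= sx.
apply: nx; split; first exact: measurable_slice.
exists [set y | N (consV (x, y))]; split => //; first exact: sx.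
by move=> y /= yN; exact: FN.
Qed.

Lemma version_zero : version (fun=> Some 0 : option R) (fun _ : 'rV[R]_d => 0).
Proof. by split => //; exists set0; split => //; exact: measure0. Qed.

Lemma measurable_oitv (a b : \bar R) :
  measurable [set x : measurableTypeR R | (a < x%:E < b)%E].
Proof.
rewrite (_ : mkset _ = (setT `&` [set x | (a < x%:E)%E]) `&`
    (setT `&` [set x | (x%:E < b)%E])).
  have mE : measurable_fun setT (EFin : measurableTypeR R -> \bar R).
    exact: EFin_measurable.
  apply: measurableI; first exact: emeasurable_fun_o_infty.
  exact: emeasurable_fun_infty_o.
by apply/seteqP; split=> x /=; [move=> /andP[-> ->]|move=> [[_ ->] [_ ->]]].
Qed.


Section Main.
Variables (a b : \bar R) (alpha beta : 'I_d -> \bar R).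
Variable f : 'rV[R]_(1 + d) -> option R.
Let I := open_interval a b.
Let B := open_box alpha beta.
Let P : set 'rV[R]_(1 + d) := prod_set I B.
Hypothesis hf : summable_on P f.
Let F := extend0 P f.

Let Fq : quasicontinuous +oo F. Proof. by have [_ _ [[]]] := hf. Qed.

Lemma consV_pt (x : 'rV[R]_1) (y : 'rV[R]_d) : consV (x ord0 ord0, y) = row_mx x y.
Proof.
by congr row_mx; apply/rowP => i; rewrite mxE [i]ord1.
Qed.

Lemma prod_set_consV (x : 'rV[R]_1) y : P (consV (x ord0 ord0, y)) <-> I x /\ B y.
Proof. by rewrite consV_pt /P /prod_set /= row_mxKl row_mxKr. Qed.

Lemma extend0_slice (x : 'rV[R]_1) : I x ->
  extend0 B (slice f x) = (fun y => F (consV (x ord0 ord0, y))).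
Proof.
move=> Ix; apply/funext => y; rewrite /F /extend0.
have -> : (consV (x ord0 ord0, y) \in P) = (y \in B).
  apply/idP/idP => [/set_mem/prod_set_consV[_ By]|/set_mem By]; apply/mem_set => //.
  exact/prod_set_consV.
by rewrite consV_pt.
Qed.

(** This makes the integrals of the slices vanish outside (a, b), in agreement
    with the extension of the partial integral by 0. *)
Lemma extend0_slice_out (x : 'rV[R]_1) : ~ I x ->
  (fun y => F (consV (x ord0 ord0, y))) = (fun=> Some 0).
Proof.
move=> nIx; apply/funext => y; rewrite /F /extend0 memNset//.
by move=> /prod_set_consV[].
Qed.

Lemma summable_slice (x : 'rV[R]_1) (h : 'rV[R]_d -> R) : I x ->
  quasicontinuous +oo (fun y => F (consV (x ord0 ord0, y))) ->
  quasicontinuous +oo (fun y => Some (\1_P (consV (x ord0 ord0, y)) : R)) ->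
  version (fun y => F (consV (x ord0 ord0, y))) h ->
  (leb d).-integrable setT (fun y => (h y)%:E) ->
  summable_on B (slice f x).
Proof.
move=> Ix qF q1 vF iF; split.
- congr (quasicontinuous _ _) : q1; apply/funext => y; congr Some.
  rewrite !indicE; congr (nat_of_bool _)%:R.
  apply/idP/idP => [/set_mem/prod_set_consV[_ By]|/set_mem By]; apply/mem_set => //.
  exact/prod_set_consV.
- have [[N [nN dN]] _] := qF; exists N; split => // y By Ny.
  have := dN y _ Ny; rewrite disc_pinfty => /(_ Logic.I).
  by rewrite -(extend0_slice Ix) /defined_at /extend0 mem_set.
- by rewrite extend0_slice//; apply/(tonelli_summableE d_gt0 qF vF).
Qed.

Lemma reduction_formula : [/\ ae_on I (fun x => summable_on B (slice f x)),
      ae_on I (defined_at (partial_integral B f)) /\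
      summable_on I (partial_integral B f) &
      integral_on P f = integral_on I (partial_integral B f)].
Proof.
have [q1P _ sF] := hf.
have [g vF] := quasicontinuous_version Fq.
have ig : (leb (1 + d)).-integrable setT (fun z => (g z)%:E).
  exact/(tonelli_summableE (ltn0Sn _) Fq vF).
have [aeI iG intG] := integral_leb ig.
pose G (x : R) := (\int[leb d]_y (g (consV (x, y)))%:E)%E.
pose Good (x : R) := [/\ quasicontinuous +oo (fun y => F (consV (x, y))),
  quasicontinuous +oo (fun y => Some (\1_P (consV (x, y)) : R)),
  version (fun y => F (consV (x, y))) (fun y => g (consV (x, y))) &
  (leb d).-integrable setT (fun y => (g (consV (x, y)))%:E)].
have [N [mN N0 NG]] : exists N : set (measurableTypeR R),
    [/\ measurable N, lebesgue_measure N = 0%E & forall x, ~ N x -> Good x].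
  have [A1 [mA1 A10 A1s]] := quasicontinuous_slice d_gt0 Fq.
  have [A2 [mA2 A20 A2s]] := quasicontinuous_slice d_gt0 q1P.
  have [A3 [mA3 A30 A3s]] := version_slice vF.
  have [A4 [mA4 A40 A4s]] := aeI.
  have m12 : measurable (A1 `|` A2) by exact: measurableU.
  have m34 : measurable (A3 `|` A4) by exact: measurableU.
  exists ((A1 `|` A2) `|` (A3 `|` A4)); split; first exact: measurableU.
    by rewrite !measureU0.
  move=> x nx; split; apply: contrapT => nP; apply: nx.
  - by left; left; apply: A1s.
  - by left; right; apply: A2s.
  - by right; left; apply: A3s.
  - by right; right; apply: A4s.
(* G is infinite only on a null set; there Phi is 0. *)
pose Phi x := fine (G x).
have mG : measurable_fun setT (G : measurableTypeR R -> \bar R).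
  exact: measurable_int iG.
have mPhi : measurable_fun setT (Phi : measurableTypeR R -> R).
  by apply: measurableT_comp => //; exact: fine_measurable.
have GoodG x : Good x -> tonelli_integral (fun y => F (consV (x, y))) = G x.
  by move=> [qF _ vx _]; rewrite (tonelli_integralE d_gt0 qF vx).
have GoodPhi x : Good x -> ((Phi x)%:E = G x)%E.
  by move=> [_ _ _ ix]; rewrite fineK//; exact: integrable_fin_num.
have iPhi : (@lebesgue_measure R).-integrable setT (fun x => (Phi x)%:E).
  apply: (le_integrable measurableT _ _ iG); first exact/measurable_EFinP.
  by move=> x _; rewrite /Phi -/(G x); case: (G x) => [r||]; rewrite ?leey//= abse0.
have intPhi :
    (\int[lebesgue_measure]_x G x = \int[lebesgue_measure]_x (Phi x)%:E)%E.
  apply: ae_eq_integral => //; first exact/measurable_EFinP.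
  exists N; split => // x /= nx; apply: contrapT => Nx; apply: nx => _.
  by rewrite GoodPhi//; exact: NG.
have Isum (x : 'rV[R]_1) : ~ N (x ord0 ord0) -> I x -> summable_on B (slice f x).
  by move=> /NG[qF q1 vx ix] Ix; exact: summable_slice vx ix.
pose p := extend0 I (partial_integral B f).
have pE (x : 'rV[R]_1) : ~ N (x ord0 ord0) -> p x = Some (Phi (x ord0 ord0)).
  move=> Nx; have Gx := NG _ Nx; rewrite /p /extend0.
  have [Ix|nIx] := pselect (I x).
    rewrite mem_set// /partial_integral; case: asboolP => [_|[]]; last exact: Isum.
    by rewrite /integral_on extend0_slice// GoodG.
  rewrite memNset//; congr Some; rewrite /Phi -GoodG// extend0_slice_out//.
  have [qF _ _ _] := Gx; rewrite extend0_slice_out// in qF.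
  by rewrite (tonelli_integralE d_gt0 qF version_zero) integral0.
have qp : quasicontinuous +oo p by exact: quasicontinuous1 mPhi mN N0 pE.
have vp := version1 mPhi mN N0 pE.
split.
- exists [set x | N (x ord0 ord0)]; split; first exact: null_set1.
  by move=> x Ix Nx; exact: Isum.
- have dI : ae_on I (defined_at (partial_integral B f)).
    exists [set x | N (x ord0 ord0)]; split; first exact: null_set1.
    move=> x Ix Nx; rewrite /defined_at /partial_integral.
    by case: asboolP => // -[]; exact: Isum.
  split => //; split => //; last first.
    apply/(tonelli_summableE (ltn0Sn _) qp vp); exact: integrable_leb1.
  apply: (@quasicontinuous1 _ _ (\1_[set x : R | (a < x%:E < b)%E]) set0) => //.
    by apply: measurable_indic; exact: measurable_oitv.
  move=> x _; congr Some; rewrite !indicE; congr (nat_of_bool _)%:R.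
  apply/idP/idP => /set_mem Ix; apply/mem_set; last by move=> i; rewrite [i]ord1.
  exact: (Ix ord0).
- rewrite /integral_on (tonelli_integralE (ltn0Sn _) Fq vF) intG intPhi.
  by rewrite (tonelli_integralE (ltn0Sn _) qp vp) integral_leb1.
Qed.
End Main.
End Reduction.

Theorem theorem165 (R : realType) (d : nat) (hd : (0 < d)%N)
    (a b : \bar R) (alpha beta : 'I_d -> \bar R)
    (f : 'rV[R]_(1 + d) -> option R)
    (hf : summable_on
            (prod_set (open_interval a b) (open_box alpha beta)) f) :
  [/\ ae_on (open_interval a b)
        (fun x => summable_on (open_box alpha beta) (slice f x)),
      ae_on (open_interval a b)
        (defined_at (partial_integral (open_box alpha beta) f)) /\
      summable_on (open_interval a b)
        (partial_integral (open_box alpha beta) f) &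
      integral_on (prod_set (open_interval a b) (open_box alpha beta)) f =
      integral_on (open_interval a b)
        (partial_integral (open_box alpha beta) f)].
Proof. exact (reduction_formula hd hf). Qed.
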